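(* (i) A proper biharmonic conformal immersion $\varphi:(\Sigma,\bar g=f^{-1}\varphi^*h)\to M^3(m,l)$ of a Hopf cylinder into a BCV space with nonconstant conformal factor $f^{1/2}$ exists only in the cases $(\Sigma,\bar g=f^{-1}\varphi^*h)\to S^2\times\mathbb{R}$, $(\Sigma,\bar g=f^{-1}\varphi^*h)\to H^2\times\mathbb{R}$ or $(\Sigma,\bar g=f^{-1}\varphi^*h)\to\mathbb{R}^3$. (ii) There exist no proper biharmonic conformal immersions of Hopf cylinders into $S^3$, $Nil$, $\widetilde{SL}(2,\mathbb{R})$ or $SU(2)$ with nonconstant conformal factor.
   Context: For real constants $m,l$, the 3-dimensional Bianchi–Cartan–Vranceanu (BCV) space is $M^3(m,l)=\big(\mathbb{R}^3,\ h=\frac{dx^2+dy^2}{[1+m(x^2+y^2)]^2}+\big[dz+\frac l2\frac{y\,dx-x\,dy}{1+m(x^2+y^2)}\big]^2\big)$ (for $m<0$, on the region $1+m(x^2+y^2)>0$). With the usual (local) identifications, $l=0$ gives $S^2\times\mathbb{R}$ ($m>0$), $H^2\times\mathbb{R}$ ($m<0$), $\mathbb{R}^3$ ($m=0$); for $l\ne0$: $S^3$ ($4m=l^2$), $SU(2)$ ($m>0$, $4m\ne l^2$), $\widetilde{SL}(2,\mathbb{R})$ ($m<0$), $Nil$ ($m=0$). The projection $\pi:M^3(m,l)\to\big(\mathbb{R}^2,h_1=\frac{dx^2+dy^2}{[1+m(x^2+y^2)]^2}\big)$, $\pi(x,y,z)=(x,y)$, is a Riemannian submersion with totally geodesic fibres.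 For an immersed regular arclength-parametrized curve $\gamma:I\to(\mathbb{R}^2,h_1)$, $\gamma(s)=(x(s),y(s))$, the Hopf cylinder is $\Sigma=\bigcup_{s\in I}\pi^{-1}(\gamma(s))$, viewed as the isometric immersion $\varphi(s,z)=(x(s),y(s),z)$ with induced metric $\varphi^*h$. Here $f$ is a positive function on $\Sigma$, and the conformal factor is $f^{1/2}$. A map $\varphi:(M,g)\to(N,h)$ is harmonic if $\tau(\varphi)=\mathrm{Trace}_g\nabla d\varphi=0$, biharmonic if $\tau_2(\varphi)=\mathrm{Trace}_g(\nabla^\varphi\nabla^\varphi-\nabla^\varphi_{\nabla^M})\tau(\varphi)-\mathrm{Trace}_g R^N(d\varphi,\tau(\varphi))d\varphi=0$ with $R^N(X,Y)Z=[\nabla^N_X,\nabla^N_Y]Z-\nabla^N_{[X,Y]}Z$, and proper biharmonic if biharmonic but not harmonic. *)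

(* Defs.v *)
From HB Require Import structures.
From mathcomp Require Import all_boot all_order all_algebra.
From mathcomp Require Import all_classical all_reals all_analysis.
Set Implicit Arguments.
Unset Strict Implicit.
Unset Printing Implicit Defensive.
Import Order.TTheory GRing.Theory Num.Theory.
Import numFieldNormedType.Exports.
Local Open Scope classical_set_scope.
Local Open Scope ring_scope.

(** Riemannian geometry in one global chart: a point of R^n is a row vector,
    a metric is the matrix field [g : 'rV_n -> 'M_n] of its coefficients
    [g p i j = g_ij(p)], and all objects are total functions which are only
    meaningful on the open set where the metric is smooth and positive
    definite. *)

Definition partial (R : realType) (n : nat) (i : 'I_n)
    (F : 'rV[R]_n -> R) (p : 'rV[R]_n) : R :=
  'D_(delta_mx 0 i) (F : 'rV[R]_n -> R^o) p.

(** C^infinity on the open set [U]: every iterated partial derivative is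
    (Frechet) differentiable at every point of [U]. *)
Definition smooth_on (R : realType) (n : nat) (U : set 'rV[R]_n)
    (F : 'rV[R]_n -> R) : Prop :=
  forall (s : seq 'I_n) (p : 'rV[R]_n), U p ->
    differentiable (foldr (@partial R n) F s : 'rV[R]_n -> R^o) p.

Definition metric (R : realType) (n : nat) := 'rV[R]_n -> 'M[R]_n.

(** [christoffel g k i j] is Gamma^k_ij. *)
Definition christoffel (R : realType) (n : nat) (g : metric R n)
    (k i j : 'I_n) (p : 'rV[R]_n) : R :=
  2^-1 * \sum_l invmx (g p) k l *
    (partial i (fun q => g q j l) p + partial j (fun q => g q i l) p
     - partial l (fun q => g q i j) p).

(** R(X, Y) Z = [nabla_X, nabla_Y] Z - nabla_[X, Y] Z at [p];
    [riemann_coef g a b c d] is the [a]-th component of R(d_c, d_d) d_b. *)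
Definition riemann_coef (R : realType) (n : nat) (g : metric R n)
    (a b c d : 'I_n) (p : 'rV[R]_n) : R :=
  partial c (christoffel g a d b) p - partial d (christoffel g a c b) p
  + \sum_e (christoffel g a c e p * christoffel g e d b p
            - christoffel g a d e p * christoffel g e c b p).

Definition riemann (R : realType) (n : nat) (g : metric R n)
    (p X Y Z : 'rV[R]_n) : 'rV[R]_n :=
  \row_a \sum_b \sum_c \sum_d
    riemann_coef g a b c d p * X 0 c * Y 0 d * Z 0 b.

(** d phi (d_i), a vector field along [phi]. *)
Definition dmap (R : realType) (n k : nat) (phi : 'rV[R]_n -> 'rV[R]_k)
    (i : 'I_n) (p : 'rV[R]_n) : 'rV[R]_k :=
  \row_a partial i (fun q => phi q 0 a) p.

Definition pullback (R : realType) (n k : nat) (phi : 'rV[R]_n -> 'rV[R]_k)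
    (h : metric R k) : metric R n :=
  fun p => \matrix_(i, j) (dmap phi i p *m h (phi p) *m (dmap phi j p)^T) 0 0.

(** nabla^phi_(d_i) W for a vector field [W] along [phi : _ -> (R^k, h)],
    where nabla^phi is the pull-back of the Levi-Civita connection of [h]. *)
Definition cov (R : realType) (n k : nat) (h : metric R k)
    (phi : 'rV[R]_n -> 'rV[R]_k) (i : 'I_n) (W : 'rV[R]_n -> 'rV[R]_k)
    (p : 'rV[R]_n) : 'rV[R]_k :=
  \row_a (partial i (fun q => W q 0 a) p +
    \sum_b \sum_c christoffel h a b c (phi p) * dmap phi i p 0 b * W p 0 c).

(** Trace_g (nabla omega) for a 1-form [omega] with values in vector fields
    along [phi] ([omega i] is its value on d_i), i.e.
    g^ij (nabla^phi_(d_i) (omega d_j) - omega (nabla_(d_i) d_j)). *)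
Definition trace_nabla (R : realType) (n k : nat) (g : metric R n)
    (h : metric R k) (phi : 'rV[R]_n -> 'rV[R]_k)
    (omega : 'I_n -> 'rV[R]_n -> 'rV[R]_k) (p : 'rV[R]_n) : 'rV[R]_k :=
  \sum_i \sum_j invmx (g p) i j *:
    (cov h phi i (omega j) p - \sum_m christoffel g m i j p *: omega m p).

(** tau(phi) = Trace_g nabla d phi *)
Definition tension (R : realType) (n k : nat) (g : metric R n)
    (h : metric R k) (phi : 'rV[R]_n -> 'rV[R]_k) : 'rV[R]_n -> 'rV[R]_k :=
  trace_nabla g h phi (dmap phi).

(** tau_2(phi) = Trace_g (nabla^phi nabla^phi - nabla^phi_nabla) tau(phi)
                 - Trace_g R^N(d phi, tau(phi)) d phi *)
Definition bitension (R : realType) (n k : nat) (g : metric R n)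
    (h : metric R k) (phi : 'rV[R]_n -> 'rV[R]_k) (p : 'rV[R]_n) : 'rV[R]_k :=
  let tau := tension g h phi in
  trace_nabla g h phi (fun j => cov h phi j tau) p
  - \sum_i \sum_j invmx (g p) i j *:
      riemann h (phi p) (dmap phi i p) (tau p) (dmap phi j p).

Definition harmonic_on (R : realType) (n k : nat) (U : set 'rV[R]_n)
    (g : metric R n) (h : metric R k) (phi : 'rV[R]_n -> 'rV[R]_k) : Prop :=
  forall p, U p -> tension g h phi p = 0.

Definition biharmonic_on (R : realType) (n k : nat) (U : set 'rV[R]_n)
    (g : metric R n) (h : metric R k) (phi : 'rV[R]_n -> 'rV[R]_k) : Prop :=
  forall p, U p -> bitension g h phi p = 0.

Definition proper_biharmonic_on (R : realType) (n k : nat)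
    (U : set 'rV[R]_n) (g : metric R n) (h : metric R k)
    (phi : 'rV[R]_n -> 'rV[R]_k) : Prop :=
  biharmonic_on U g h phi /\ ~ harmonic_on U g h phi.

(** Bianchi-Cartan-Vranceanu spaces M^3(m, l), with coordinates
    x = p_0, y = p_1, z = p_2. *)

Definition bcv_factor (R : realType) (m x y : R) : R :=
  1 + m * (x ^+ 2 + y ^+ 2).

Definition bcv_metric (R : realType) (m l : R) : metric R 3 := fun p =>
  let x := p 0 0 in
  let y := p 0 1 in
  let D := bcv_factor m x y in
  let dx : 'rV[R]_3 := delta_mx 0 0 in
  let dy : 'rV[R]_3 := delta_mx 0 1 in
  let dz : 'rV[R]_3 := delta_mx 0 2%:R in
  let theta := dz + (l / 2 / D) *: (y *: dx - x *: dy) in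
  (D ^+ 2)^-1 *: (dx^T *m dx + dy^T *m dy) + theta^T *m theta.

(** The base metric h_1 = (dx^2 + dy^2) / (1 + m (x^2 + y^2))^2 on R^2. *)
Definition bcv_base_metric (R : realType) (m : R) : metric R 2 := fun q =>
  ((bcv_factor m (q 0 0) (q 0 1)) ^+ 2)^-1 *: 1%:M.

(** s |-> (x s, y s) is a smooth arclength-parametrized curve, on the open
    interval [I], in (R^2, h_1).  The condition [0 < bcv_factor ...] confines
    the curve to the domain of h_1; it is automatic when [0 <= m]. *)
Definition arclength_curve (R : realType) (m : R) (I : set R)
    (x y : R -> R) : Prop :=
  [/\ open I, is_interval I,
      forall (k : nat) (s : R), I s ->
        derivable (derive1n k (x : R -> R^o)) s 1 /\
        derivable (derive1n k (y : R -> R^o)) s 1,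
      forall s, I s -> 0 < bcv_factor m (x s) (y s) &
      forall s, I s ->
        let v : 'rV[R]_2 := \row_i (if i == 0 then derive1 (x : R -> R^o) s
                                    else derive1 (y : R -> R^o) s) in
        let q : 'rV[R]_2 := \row_i (if i == 0 then x s else y s) in
        (v *m bcv_base_metric m q *m v^T) 0 0 = 1].

(** The Hopf cylinder over the curve: the surface I x R with coordinates
    (s, z), immersed in M^3(m, l) by phi(s, z) = (x(s), y(s), z). *)

Definition hopf_surface (R : realType) (I : set R) : set 'rV[R]_2 :=
  [set p | I (p 0 0)].

Definition hopf_map (R : realType) (x y : R -> R) (p : 'rV[R]_2) : 'rV[R]_3 :=
  \row_i (if i == 0 then x (p 0 0) else if i == 1 then y (p 0 0) else p 0 1).

(** gbar = f^-1 phi^* h, so that phi^* h = (f^(1/2))^2 gbar. *)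
Definition hopf_conformal_metric (R : realType) (m l : R) (x y : R -> R)
    (f : 'rV[R]_2 -> R) : metric R 2 := fun p =>
  (f p)^-1 *: pullback (hopf_map x y) (bcv_metric m l) p.

(** There is a proper biharmonic conformal immersion
    (Sigma, f^-1 phi^* h) -> M^3(m, l) of a Hopf cylinder with nonconstant
    conformal factor f^(1/2). *)
Definition has_proper_biharmonic_hopf (R : realType) (m l : R) : Prop :=
  exists (I : set R) (x y : R -> R) (f : 'rV[R]_2 -> R),
    [/\ arclength_curve m I x y,
        smooth_on (hopf_surface I) f,
        forall p, hopf_surface I p -> 0 < f p,
        exists p q, [/\ hopf_surface I p, hopf_surface I q &
                        Num.sqrt (f p) <> Num.sqrt (f q)] &
        proper_biharmonic_on (hopf_surface I)
          (hopf_conformal_metric m l x y f) (bcv_metric m l) (hopf_map x y)].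

Definition is_S2xR (R : realType) (m l : R) : Prop := l = 0 /\ 0 < m.
Definition is_H2xR (R : realType) (m l : R) : Prop := l = 0 /\ m < 0.
Definition is_R3 (R : realType) (m l : R) : Prop := l = 0 /\ m = 0.
Definition is_S3 (R : realType) (m l : R) : Prop := l <> 0 /\ 4 * m = l ^+ 2.
Definition is_SU2 (R : realType) (m l : R) : Prop :=
  [/\ l <> 0, 0 < m & 4 * m <> l ^+ 2].
Definition is_SL2 (R : realType) (m l : R) : Prop := l <> 0 /\ m < 0.
Definition is_Nil (R : realType) (m l : R) : Prop := l <> 0 /\ m = 0.

(* Main.v *)
Require Import Defs.
From mathcomp Require Import all_boot all_order all_algebra.
From mathcomp Require Import all_classical all_reals all_analysis.
From mathcomp Require Import ring.

(** Let e be the horizontal lift of the unit velocity of the curve, V = d_z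
    and xi the unit normal of the cylinder.  With k the geodesic curvature of
    the curve and u = f k, the tension field is u xi, and the bitension field
    vanishes exactly when
      l V(u) - 2 k e(u) - u k' = 0,   l e(u) = 0,
      (e e + V V) u = u (k^2 + l^2 - 4 m).
    If l <> 0, the first two equations say e(u) = 0 and V(u) = (k'/l) u.  Where
    k <> 0 the quotient k'/l is thus the increment of ln f over a unit step
    along a fibre, and differentiating it along e gives k'' = 0; the third
    equation reads (k'/l)^2 = k^2 + l^2 - 4 m, whence k k' = 0.  So k^2 is
    constant: either k = 0 and the immersion is harmonic, or k' = 0 and then
    f is constant. *)

Set Implicit Arguments.
Unset Strict Implicit.
Unset Printing Implicit Defensive.
Import Order.TTheory GRing.Theory Num.Theory.
Import numFieldNormedType.Exports.
Local Open Scope classical_set_scope.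
Local Open Scope ring_scope.

(** * Differentiation rules for real-valued functions on a normed space *)

Section Calculus.
Variables (R : realType) (V : normedModType R) (p v : V).
Implicit Types f g : V -> R.

Lemma is_derive_lcst (c : R) : is_derive p v ((fun=> c) : V -> R^o) 0.
Proof. exact: is_derive_cst. Qed.

Lemma is_derive_ladd f g (df dg : R) :
  is_derive p v (f : V -> R^o) df -> is_derive p v (g : V -> R^o) dg ->
  is_derive p v ((fun q => f q + g q) : V -> R^o) (df + dg).
Proof. exact: is_deriveD. Qed.

Lemma is_derive_lopp f (df : R) :
  is_derive p v (f : V -> R^o) df ->
  is_derive p v ((fun q => - f q) : V -> R^o) (- df).
Proof. exact: is_deriveN. Qed.

Lemma is_derive_lmul f g (df dg : R) :
  is_derive p v (f : V -> R^o) df -> is_derive p v (g : V -> R^o) dg ->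
  is_derive p v ((fun q => f q * g q) : V -> R^o) (f p * dg + g p * df).
Proof. exact: is_deriveM. Qed.

Lemma is_derive_lexp f n (df : R) :
  is_derive p v (f : V -> R^o) df ->
  is_derive p v ((fun q => f q ^+ n) : V -> R^o) (n%:R * f p ^+ n.-1 * df).
Proof.
move=> fdf; have := @is_deriveX _ _ f n p v df fdf.
by congr (is_derive _ _ _ _); apply/funext => q; rewrite exprfctE.
Qed.

Lemma is_derive_linv f (df : R) :
  f p != 0 -> is_derive p v (f : V -> R^o) df ->
  is_derive p v ((fun q => (f q)^-1) : V -> R^o) (- (f p) ^- 2 * df).
Proof.
move=> fp0 fdf; apply: DeriveDef; first exact: derivableV.
by rewrite deriveV// derive_val.
Qed.

End Calculus.

(* Instance resolution would solve some of the subgoals through the library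
   instances, in terms of [*:] on [R^o], on which [ring] fails. *)
Ltac isd :=
  repeat first
    [ eassumption
    | notypeclasses refine (is_derive_lcst _ _ _)
    | notypeclasses refine (is_derive_ladd _ _)
    | notypeclasses refine (is_derive_lopp _)
    | notypeclasses refine (is_derive_lmul _ _)
    | notypeclasses refine (is_derive_lexp _ _) ].

(** * Partial derivatives and coordinate functions on R^n *)

Section Partial.
Variables (R : realType) (n : nat).
Implicit Types (F G : 'rV[R]_n -> R) (p : 'rV[R]_n) (i : 'I_n).

Lemma partial_val i F p (d : R) :
  is_derive p (delta_mx 0 i) (F : _ -> R^o) d -> partial i F p = d.
Proof. by case. Qed.

Lemma near_eq_partial i F G p :
  (\near p, F p = G p) -> partial i F p = partial i G p.
Proof. exact: (@near_eq_derive _ _ R^o). Qed.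

(** A coordinate is linear, so its difference quotient is constant for nonzero increments. *)
Lemma is_derive_coord p (v : 'rV[R]_n) j :
  is_derive p v ((fun q => q 0 j) : 'rV[R]_n -> R^o) (v 0 j).
Proof.
suff c : (fun h : R => h^-1 *: (((h *: v + p) 0 j : R^o) - p 0 j)) @ 0^'
   --> v 0 j.
  by apply: DeriveDef; [apply/cvg_ex; exists (v 0 j)|apply: cvg_lim].
apply: (@cvg_trans _ ((cst (v 0 j) : R -> R) @ 0^')); last exact: cvg_cst.
apply: near_eq_cvg; near=> h; rewrite /= !mxE addrK scalerA mulVf ?scale1r//.
by near: h; exact: nbhs_dnbhs_neq.
Unshelve. all: by end_near. Qed.

End Partial.

(** * Finite index sets of size 2 and 3, and inverse matrices *)

Lemma ord3_ind (P : 'I_3 -> Prop) : P 0 -> P 1 -> P 2%:R -> forall i, P i.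
Proof.
move=> P0 P1 P2 [[|[|[|//]]] i_lt].
- by rewrite (_ : Ordinal _ = 0)//; exact: val_inj.
- by rewrite (_ : Ordinal _ = 1)//; exact: val_inj.
- by rewrite (_ : Ordinal _ = 2%:R)//; exact: val_inj.
Qed.

Lemma ord2_ind (P : 'I_2 -> Prop) : P 0 -> P 1 -> forall i, P i.
Proof.
move=> P0 P1 [[|[|//]] i_lt].
- by rewrite (_ : Ordinal _ = 0)//; exact: val_inj.
- by rewrite (_ : Ordinal _ = 1)//; exact: val_inj.
Qed.

Lemma big_ord3 (V : nmodType) (F : 'I_3 -> V) :
  \sum_i F i = F 0 + F 1 + F 2%:R.
Proof.
rewrite !big_ord_recl big_ord0 addr0 addrA.
by congr (F _ + F _ + F _); apply: val_inj.
Qed.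

Lemma big_ord2 (V : nmodType) (F : 'I_2 -> V) : \sum_i F i = F 0 + F 1.
Proof.
rewrite !big_ord_recl big_ord0 addr0.
by congr (F _ + F _); apply: val_inj.
Qed.

Lemma ord3E : (((0 : 'I_3) == 1) = false) * (((0 : 'I_3) == 2%:R) = false) *
  (((1 : 'I_3) == 0) = false) * (((1 : 'I_3) == 2%:R) = false) *
  (((2%:R : 'I_3) == 0) = false) * (((2%:R : 'I_3) == 1) = false) *
  (((0 : 'I_2) == 1) = false) * (((1 : 'I_2) == 0) = false).
Proof. by []. Qed.

Lemma ord3_nat : (nat_of_ord (0 : 'I_3) = 0%N) * (nat_of_ord (1 : 'I_3) = 1%N) *
  (nat_of_ord (2%:R : 'I_3) = 2%N).
Proof. by []. Qed.

(** A right inverse of a square matrix is two-sided. Explicit inverse metrics are thus certified by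
    one matrix product. *)
Lemma invmx_right (R : comUnitRingType) n (M N : 'M[R]_n) :
  M *m N = 1%:M -> invmx M = N.
Proof.
move=> MN; have [uM _] := mulmx1_unit MN.
by rewrite -[RHS]mul1mx -(mulVmx uM) -mulmxA MN mulmx1.
Qed.

(** * Traces and Christoffel symbols over a surface *)

Section Dim2.
Variables (R : realType) (k : nat) (g : metric R 2) (h : metric R k).
Variable phi : 'rV[R]_2 -> 'rV[R]_k.

Lemma trace_nabla2 (omega : 'I_2 -> 'rV[R]_2 -> 'rV[R]_k) p c :
  trace_nabla g h phi omega p 0 c =
  (let t i j := invmx (g p) i j * (cov h phi i (omega j) p 0 c -
    (christoffel g 0 i j p * omega 0 p 0 c +
     christoffel g 1 i j p * omega 1 p 0 c)) in
  t 0 0 + t 0 1 + (t 1 0 + t 1 1)).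
Proof.
rewrite /trace_nabla.
(* Without this generalization, [big_ord2] makes the unifier unfold derivatives
   in order to compare the terms for the indices 0 and 1. *)
move: (cov h phi) (christoffel g) (invmx (g p)) => K G M.
by rewrite !big_ord2 !mxE.
Qed.

Lemma christoffel2 a i j p :
  christoffel g a i j p =
  (let t b := invmx (g p) a b * (partial i (fun q => g q j b) p +
     partial j (fun q => g q i b) p - partial b (fun q => g q i j) p) in
  2^-1 * (t 0 + t 1)).
Proof. by rewrite /christoffel big_ord2. Qed.

End Dim2.

(** * Metric and Levi-Civita connection of the BCV spaces *)

Section BCV.
Variables (R : realType) (m l : R).

(* In the BCV formulas [w] stands for [1 / (1 + m (x^2 + y^2))];
   [bcv_form] lists the coefficients of theta = dz + (l/2) w (y dx - x dy), and
   h = w^2 (dx^2 + dy^2) + theta^2. *)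
Definition bcv_form (x y w : R) (i : nat) : R :=
  match i with 0 => l / 2 * w * y | 1 => - (l / 2 * w * x) | _ => 1 end.

Definition bcv_coef (x y w : R) (i j : nat) : R :=
  w ^+ 2 * ((i == j) && (i < 2)%N)%:R + bcv_form x y w i * bcv_form x y w j.

Definition bcv_w (p : 'rV[R]_3) : R := (bcv_factor m (p 0 0) (p 0 1))^-1.

Lemma bcv_metricE p i j :
  bcv_metric m l p i j = bcv_coef (p 0 0) (p 0 1) (bcv_w p) i j.
Proof.
rewrite /bcv_metric /bcv_coef /bcv_w; set D := bcv_factor _ _ _.
rewrite !mxE big_ord1 !mxE !big_ord1 !mxE -exprVn.
move: i j; apply: ord3_ind; apply: ord3_ind; rewrite !ord3_nat !ord3E !eqxx /=;
  ring.
Qed.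

Local Notation w := bcv_w.

(** Closed form of the Christoffel symbols Gamma^k_ij, with [n] for l^2. Indices are natural numbers
    so that the [match] reduces on literals. *)
Definition bcv_chris (x y w : R) (k i j : nat) : R :=
  let n := l ^+ 2 in
  match k, i, j with
  | 0, 0, 0 => - (2 * m * x * w)
  | 0, 0, 1 | 0, 1, 0 => (n / 4 - 2 * m) * y * w
  | 0, 1, 1 => (2 * m - n / 2) * x * w
  | 1, 0, 0 => (2 * m - n / 2) * y * w
  | 1, 0, 1 | 1, 1, 0 => (n / 4 - 2 * m) * x * w
  | 1, 1, 1 => - (2 * m * y * w)
  | 0, 1, 2 | 0, 2, 1 => l / 2
  | 1, 0, 2 | 1, 2, 0 => - (l / 2)
  | 2, 0, 2 | 2, 2, 0 => - (n / 4 * x * w)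
  | 2, 1, 2 | 2, 2, 1 => - (n / 4 * y * w)
  | 2, 0, 0 => l / 4 * (4 * m - n) * x * y * w ^+ 2
  | 2, 1, 1 => l / 4 * (n - 4 * m) * x * y * w ^+ 2
  | 2, 0, 1 | 2, 1, 0 => l / 8 * (n - 4 * m) * (x ^+ 2 - y ^+ 2) * w ^+ 2
  | _, _, _ => 0
  end.

(** The inverse metric is the sum of the squares E E^T over the orthonormal frame w^-1 (d_x - (l/2)
    w y d_z), w^-1 (d_y + (l/2) w x d_z), d_z. *)
Definition bcv_inv (x y w : R) (i j : nat) : R :=
  match i, j with
  | 0, 0 | 1, 1 => w ^- 2
  | 0, 2 | 2, 0 => - (l / 2 * y / w)
  | 1, 2 | 2, 1 => l / 2 * x / w
  | 2, 2 => 1 + (l / 2) ^+ 2 * (x ^+ 2 + y ^+ 2)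
  | _, _ => 0
  end.

Lemma bcv_invE (p : 'rV[R]_3) i j : w p != 0 ->
  invmx (bcv_metric m l p) i j = bcv_inv (p 0 0) (p 0 1) (w p) i j.
Proof.
move=> w0; set N : 'M[R]_3 := \matrix_(i, j) bcv_inv (p 0 0) (p 0 1) (w p) i j.
have MN : bcv_metric m l p *m N = 1%:M.
  apply/matrixP => a b; rewrite mxE big_ord3 !bcv_metricE !mxE /bcv_coef.
  move: a b; apply: ord3_ind; apply: ord3_ind;
    rewrite !ord3_nat ?ord3E ?eqxx /=;
  by field.
by rewrite (invmx_right MN) mxE.
Qed.

Definition bcv_dw (x y w : R) (k : nat) : R :=
  match k with
  | 0 => - (2 * m * x * w ^+ 2) | 1 => - (2 * m * y * w ^+ 2) | _ => 0
  end.

Definition coord_d (i : nat) (k : nat) : R := (i == k)%:R.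

Lemma is_derive_bcv_x (p : 'rV[R]_3) (k : 'I_3) :
  is_derive p (delta_mx 0 k) ((fun q => q 0 0) : 'rV[R]_3 -> R^o) (coord_d 0 k).
Proof.
have := is_derive_coord p (delta_mx 0 k) 0; rewrite mxE eqxx /=.
by rewrite /coord_d.
Qed.

Lemma is_derive_bcv_y (p : 'rV[R]_3) (k : 'I_3) :
  is_derive p (delta_mx 0 k) ((fun q => q 0 1) : 'rV[R]_3 -> R^o) (coord_d 1 k).
Proof.
have := is_derive_coord p (delta_mx 0 k) 1; rewrite mxE eqxx /=.
by rewrite /coord_d.
Qed.

Lemma is_derive_bcv_w (p : 'rV[R]_3) (k : 'I_3) : w p != 0 ->
  is_derive p (delta_mx 0 k) (w : 'rV[R]_3 ->
    R^o) (bcv_dw (p 0 0) (p 0 1) (w p) k).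
Proof.
move=> w0; have D0 : bcv_factor m (p 0 0) (p 0 1) != 0.
  by rewrite -invr_eq0.
have dx := is_derive_bcv_x p k; have dy := is_derive_bcv_y p k.
notypeclasses refine (is_derive_eq _ _).
  notypeclasses refine (is_derive_linv _ _); [exact: D0|rewrite /bcv_factor;
    isd].
rewrite /coord_d.
move: k {dx dy}; apply: ord3_ind; rewrite ?ord3_nat /bcv_w /bcv_factor /=;
  field; exact: D0.
Qed.

Definition bcv_dform (x y w : R) (k i : nat) : R :=
  match i with
  | 0 => l / 2 * (w * coord_d 1 k + y * bcv_dw x y w k)
  | 1 => - (l / 2 * (w * coord_d 0 k + x * bcv_dw x y w k))
  | _ => 0
  end.

Lemma is_derive_bcv_form (p : 'rV[R]_3) (k : 'I_3) i : w p != 0 ->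
  is_derive p (delta_mx 0 k) ((fun q =>
    bcv_form (q 0 0) (q 0 1) (w q) i) : 'rV[R]_3 -> R^o)
   (bcv_dform (p 0 0) (p 0 1) (w p) k i).
Proof.
move=> w0; have dx := is_derive_bcv_x p k; have dy := is_derive_bcv_y p k.
have dw := is_derive_bcv_w k w0.
case: i => [|[|i]]; rewrite /bcv_form /bcv_dform;
  (notypeclasses refine (is_derive_eq _ _); [isd|cbv beta; ring]).
Qed.

Definition bcv_dcoef (x y w : R) (k i j : nat) : R :=
  2 * w * bcv_dw x y w k * ((i == j) && (i < 2)%N)%:R +
  bcv_dform x y w k i * bcv_form x y w j +
  bcv_form x y w i * bcv_dform x y w k j.

Lemma partial_bcv_metric p k i j : w p != 0 ->
  partial k (fun q => bcv_metric m l q i j) p =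
  bcv_dcoef (p 0 0) (p 0 1) (w p) k i j.
Proof.
move=> w0; rewrite (_ : (fun q : 'rV[R]_3 => _) =
   fun q => bcv_coef (q 0 0) (q 0 1) (w q) i j); last first.
  by apply/funext => q; rewrite bcv_metricE.
have dw := is_derive_bcv_w k w0.
have di := is_derive_bcv_form k i w0; have dj := is_derive_bcv_form k j w0.
apply: partial_val; notypeclasses refine (is_derive_eq _ _);
  first by rewrite /bcv_coef; isd.
rewrite /bcv_dcoef /=; ring.
Qed.

Lemma bcv_christoffelE p k i j : w p != 0 ->
  christoffel (bcv_metric m l) k i j p =
  bcv_chris (p 0 0) (p 0 1) (w p) k i j.
Proof.
move=> w0; rewrite /christoffel big_ord3 !bcv_invE// !partial_bcv_metric//.
have D0 : 1 + m * (p 0 0 ^+ 2 + p 0 1 ^+ 2) != 0.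
  by rewrite -invr_eq0.
(* Unfolding [w] gives [field] access to the relation w (1 + m (x^2 + y^2)) = 1. *)
move: k i j; apply: ord3_ind; apply: ord3_ind; apply: ord3_ind;
 rewrite /bcv_dcoef !ord3_nat /bcv_w /= /bcv_factor /bcv_dw /coord_d /=;
   by field.
Qed.

(** * Curvature tensor of the BCV spaces *)

Lemma near_bcv_w (p : 'rV[R]_3) : w p != 0 -> \near p, w p != 0.
Proof.
rewrite /bcv_w invr_eq0 => D0.
have c : {for p, continuous (fun q : 'rV[R]_3 => bcv_factor m (q 0 0) (q 0 1))}.
  have cx j : (fun q : 'rV[R]_3 => q 0 j) @ p --> p 0 j.
    exact: coord_continuous.
  exact: (cvgD (cvg_cst _) (cvgM (cvg_cst _) (cvgD (cvgM (cx _) (cx _)) (cvgM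
    (cx _) (cx _))))).
near=> q; rewrite invr_eq0; near: q.
by apply: (cvgr_neq0 _ c).
Unshelve. all: by end_near. Qed.

(* R(X, Y) Z = al (<Y,Z> X - <X,Z> Y) + be (th(Y) th(Z) X - th(X) th(Z) Y
   + (th(X) <Y,Z> - th(Y) <X,Z>) d_z): al is the curvature of horizontal planes,
   al + be = l^2 / 4 that of vertical ones. *)
Definition bcv_riemann (x y w : R) (a b c d : nat) : R :=
  let al := 4 * m - 3 / 4 * l ^+ 2 in
  let be := l ^+ 2 - 4 * m in
  let h := bcv_coef x y w in
  let th := bcv_form x y w in
  al * (h d b * (a == c)%:R - h c b * (a == d)%:R) +
  be * (th d * th b * (a == c)%:R - th c * th b * (a == d)%:R +
        (th c * h d b - th d * h c b) * (a == 2)%:R).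

Lemma riemann_coef_anti n (g : metric R n) a b c d p :
  riemann_coef g a b c d p = - riemann_coef g a b d c p.
Proof.
rewrite /riemann_coef opprD opprB -sumrN; congr (_ + _).
by apply: eq_bigr => e _; rewrite opprB.
Qed.

Lemma bcv_riemann_anti x y v a b c d :
  bcv_riemann x y v a b c d = - bcv_riemann x y v a b d c.
Proof. by rewrite /bcv_riemann; ring. Qed.

(** The Christoffel symbols agree with their closed forms on a whole neighbourhood of p, where w
    stays nonzero, so the closed forms may be differentiated instead. The values [d1] and [d2] are
    left open for [isd] to find. *)
Lemma riemann_of_derive (p : 'rV[R]_3) (a b c d : 'I_3) (d1 d2 k : R)
  (G := fun i j k => bcv_chris (p 0 0) (p 0 1) (w p) i j k) :
  w p != 0 ->
  is_derive p (delta_mx 0 c) ((fun q =>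
    bcv_chris (q 0 0) (q 0 1) (w q) a d b) : 'rV[R]_3 -> R^o) d1 ->
  is_derive p (delta_mx 0 d) ((fun q =>
    bcv_chris (q 0 0) (q 0 1) (w q) a c b) : 'rV[R]_3 -> R^o) d2 ->
  d1 - d2 + (G a c 0 * G 0 d b - G a d 0 * G 0 c b
           + (G a c 1 * G 1 d b - G a d 1 * G 1 c b)
           + (G a c 2%N * G 2%N d b - G a d 2%N * G 2%N c b)) = k ->
  riemann_coef (bcv_metric m l) a b c d p = k.
Proof.
move=> w0 h1 h2 <-.
rewrite /riemann_coef big_ord3 !bcv_christoffelE//.
rewrite -(partial_val h1) -(partial_val h2).
congr (_ - _ + _); apply: near_eq_partial; near=> q; apply: bcv_christoffelE;
  near: q; exact: near_bcv_w.
Unshelve. all: by end_near. Qed.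

(** By antisymmetry in c and d, only the pairs (0,1), (0,2) and (1,2) need a computation. *)
Lemma bcv_riemannE (p : 'rV[R]_3) a b c d : w p != 0 ->
  riemann_coef (bcv_metric m l) a b c d p =
  bcv_riemann (p 0 0) (p 0 1) (w p) a b c d.
Proof.
move=> w0.
have diag e : riemann_coef (bcv_metric m l) a b e e p =
  bcv_riemann (p 0 0) (p 0 1) (w p) a b e e.
  rewrite /riemann_coef /bcv_riemann subrr big1 ?addr0 => [|i _];
    last by rewrite subrr.
  by ring.
have D0 : 1 + m * (p 0 0 ^+ 2 + p 0 1 ^+ 2) != 0.
  by rewrite -invr_eq0.
have dx0 := is_derive_bcv_x p 0; have dy0 := is_derive_bcv_y p 0.
have dw0 := is_derive_bcv_w 0 w0.
have dx1 := is_derive_bcv_x p 1; have dy1 := is_derive_bcv_y p 1.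
have dw1 := is_derive_bcv_w 1 w0.
have dx2 := is_derive_bcv_x p 2%:R; have dy2 := is_derive_bcv_y p 2%:R.
have dw2 := is_derive_bcv_w 2%:R w0.
have [r01 r02 r12] : [/\ riemann_coef (bcv_metric m l) a b 0 1 p =
    bcv_riemann (p 0 0) (p 0 1) (w p) a b 0 1,
  riemann_coef (bcv_metric m l) a b 0 2%:R p =
    bcv_riemann (p 0 0) (p 0 1) (w p) a b 0 2 &
  riemann_coef (bcv_metric m l) a b 1 2%:R p =
    bcv_riemann (p 0 0) (p 0 1) (w p) a b 1 2].
  clear diag; split; move: a b; apply: ord3_ind; apply: ord3_ind;
  (notypeclasses refine (riemann_of_derive w0 _ _ _); rewrite ?ord3_nat /=;
    [isd|isd|]);
  rewrite /bcv_riemann /bcv_coef ?ord3_nat /coord_d /= /bcv_w /bcv_factor /=;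
  field; exact: D0.
move: c d; apply: ord3_ind; apply: ord3_ind => //;
  by rewrite riemann_coef_anti bcv_riemann_anti ?r01 ?r02 ?r12.
Qed.

(** This is h(X, d_z), the vertical component of X. *)
Definition bcv_theta (p X : 'rV[R]_3) : R :=
  l / 2 * w p * (p 0 1 * X 0 0 - p 0 0 * X 0 1) + X 0 2%:R.

Definition bcv_ip (p X Y : 'rV[R]_3) : R :=
  w p ^+ 2 * (X 0 0 * Y 0 0 + X 0 1 * Y 0 1) + bcv_theta p X * bcv_theta p Y.

Lemma bcv_metric_ip p X Y :
  (X *m bcv_metric m l p *m Y^T) 0 0 = bcv_ip p X Y.
Proof.
rewrite mxE big_ord3 ![(X *m _) _ _]mxE !big_ord3 !bcv_metricE !mxE /bcv_coef.
by rewrite !ord3_nat /bcv_ip /bcv_theta /=; ring.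
Qed.

(** Every term of the curvature tensor along X or d_z carries a factor theta(Y) or h(Y, Z). It
    serves for Y the tension field, normal to the cylinder, and X, Z tangent to it. *)
Lemma bcv_riemann_normal p X Y Z : w p != 0 ->
  bcv_theta p Y = 0 -> bcv_ip p Y Z = 0 ->
  riemann (bcv_metric m l) p X Y Z =
  - ((4 * m - 3 / 4 * l ^+ 2) * bcv_ip p X Z +
     (l ^+ 2 - 4 * m) * bcv_theta p X * bcv_theta p Z) *: Y.
Proof.
move=> w0 tY iY.
have E a : riemann (bcv_metric m l) p X Y Z 0 a =
   (4 * m - 3 / 4 * l ^+ 2) * (bcv_ip p Y Z * X 0 a - bcv_ip p X Z * Y 0 a) +
   (l ^+ 2 - 4 * m) * (bcv_theta p Y * bcv_theta p Z * X 0 a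
     - bcv_theta p X * bcv_theta p Z * Y 0 a +
     (bcv_theta p X * bcv_ip p Y Z - bcv_theta p Y * bcv_ip p X Z) * (a ==
       2%:R)%:R).
  rewrite /riemann mxE.
  under eq_bigr do under eq_bigr do under eq_bigr do rewrite bcv_riemannE//.
  rewrite !big_ord3 /bcv_riemann /bcv_coef /bcv_ip /bcv_theta.
  move: a; apply: ord3_ind; rewrite ?ord3_nat ?ord3E ?eqxx /=; ring.
apply/rowP => a; rewrite E tY iY !mxE; ring.
Qed.

End BCV.

(** * Differentiation along the coordinate lines of R^2 *)

Section Slices.
Variable R : realType.

Lemma is_derive_fst (F : R -> R^o) (p : 'rV[R]_2) (d : R) :
  is_derive (p 0 0) 1 F d ->
  is_derive p (delta_mx 0 0) ((fun q => F (q 0 0)) : 'rV[R]_2 -> R^o) d.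
Proof.
move=> [Fd <-].
have E : (fun h : R => h^-1 *: (((fun q : 'rV[R]_2 =>
  F (q 0 0) : R^o) \o shift p)
      (h *: delta_mx 0 0) - F (p 0 0))) =
    (fun h : R => h^-1 *: ((F \o shift (p 0 0)) (h *: 1) - F (p 0 0))).
  by apply/funext => h /=; rewrite !mxE.
by split; rewrite /derivable /derive E.
Qed.

Lemma is_derive_fst0 (F : R -> R^o) (p : 'rV[R]_2) :
  is_derive p (delta_mx 0 1) ((fun q => F (q 0 0)) : 'rV[R]_2 -> R^o) 0.
Proof.
have E : (fun h : R => h^-1 *: (((fun q : 'rV[R]_2 =>
  F (q 0 0) : R^o) \o shift p)
      (h *: delta_mx 0 1) - F (p 0 0))) =
    (fun h : R => 0 : R^o).
  by apply/funext => h /=; rewrite !mxE /= mulr0 add0r subrr scaler0.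
split; first by rewrite /derivable E; exact: is_cvg_cst.
by rewrite /derive E; apply: cvg_lim => //; exact: cvg_cst.
Qed.

Definition pt (s z : R) : 'rV[R]_2 := \row_i (if i == 0 then s else z).

Lemma pt_eta (p : 'rV[R]_2) : pt (p 0 0) (p 0 1) = p.
Proof. by apply/rowP; apply: ord2_ind; rewrite mxE. Qed.

Lemma is_derive_slice0 (f : 'rV[R]_2 -> R^o) s z (d : R) :
  is_derive (pt s z) (delta_mx 0 0) f d ->
  is_derive s 1 ((fun s => f (pt s z)) : R -> R^o) d.
Proof.
move=> [fd <-].
have E : (fun h : R => h^-1 *: (((fun s => f (pt s z)) \o shift s)
      (h *: 1) - f (pt s z))) =
    (fun h : R => h^-1 *: ((f \o shift (pt s z)) (h *: delta_mx 0 0) - f (pt s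
      z))).
  apply/funext => h /=; congr (_ *: (f _ - _)); apply/rowP.
  by apply: ord2_ind; rewrite !mxE /= ?mulr0 ?add0r.
by split; rewrite /derivable /derive E.
Qed.

Lemma is_derive_slice1 (f : 'rV[R]_2 -> R^o) s z (d : R) :
  is_derive (pt s z) (delta_mx 0 1) f d ->
  is_derive z 1 ((fun z => f (pt s z)) : R -> R^o) d.
Proof.
move=> [fd <-].
have E : (fun h : R => h^-1 *: (((fun z => f (pt s z)) \o shift z)
      (h *: 1) - f (pt s z))) =
    (fun h : R => h^-1 *: ((f \o shift (pt s z)) (h *: delta_mx 0 1) - f (pt s
      z))).
  apply/funext => h /=; congr (_ *: (f _ - _)); apply/rowP.
  by apply: ord2_ind; rewrite !mxE /= ?mulr0 ?add0r.
by split; rewrite /derivable /derive E.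
Qed.

End Slices.

(** Proves an identity modulo three relations P = Q = S = 0. The c_i are explicit cofactors, and the
    last premise is a plain algebraic identity. *)
Lemma lincomb3 (R : comPzRingType) (A B P Q S c1 c2 c3 : R) :
  P = 0 -> Q = 0 -> S = 0 -> A - B = c1 * P + c2 * Q + c3 * S -> A = B.
Proof. by move=> -> -> -> /eqP; rewrite !mulr0 !addr0 subr_eq0 => /eqP. Qed.

Lemma is_derive1n (R : realType) (F : R -> R^o) k s :
  derivable (derive1n k F) s 1 ->
    is_derive s 1 (derive1n k F) (derive1n k.+1 F s).
Proof. by move=> /derivableP; rewrite derive1nS derive1E. Qed.

(** * Geometry of the base curve *)

(* [X k] and [Y k] stand for the k-th derivatives of the two coordinates. *)
Section Curve.
Variables (R : realType) (m l : R) (I : set R) (X Y : nat -> R -> R).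
Hypothesis openI : open I.
Hypothesis curve_dx : forall k s, I s -> is_derive s 1 (X k : R ->
  R^o) (X k.+1 s).
Hypothesis curve_dy : forall k s, I s -> is_derive s 1 (Y k : R ->
  R^o) (Y k.+1 s).
Hypothesis curve_D0 : forall s, I s -> bcv_factor m (X 0 s) (Y 0 s) != 0.
Hypothesis curve_speed : forall s, I s ->
  X 1 s ^+ 2 + Y 1 s ^+ 2 = bcv_factor m (X 0 s) (Y 0 s) ^+ 2.
Implicit Types s : R.

Definition curve_w s : R := (bcv_factor m (X 0 s) (Y 0 s))^-1.
Local Notation W := curve_w.

(* theta (d_s phi) *)
Definition slope s : R := l / 2 * W s * (Y 0 s * X 1 s - X 0 s * Y 1 s).

(* The geodesic curvature of the curve. *)
Definition curv s : R :=
  (X 1 s * Y 2 s - X 2 s * Y 1 s) * W s ^+ 2 +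
  2 * m * (Y 0 s * X 1 s - X 0 s * Y 1 s) * W s.

Definition dcurve_w s : R := - (2 * m * (X 0 s * X 1 s + Y 0 s * Y 1 s) * W s
  ^+ 2).

Definition dslope s : R :=
  l / 2 * (dcurve_w s * (Y 0 s * X 1 s - X 0 s * Y 1 s) +
           W s * (Y 0 s * X 2 s - X 0 s * Y 2 s)).

Definition dcurv s : R :=
  (X 1 s * Y 3 s - X 3 s * Y 1 s) * W s ^+ 2 +
  (X 1 s * Y 2 s - X 2 s * Y 1 s) * (2 * W s * dcurve_w s) +
  2 * m * ((Y 0 s * X 2 s - X 0 s * Y 2 s) * W s +
           (Y 0 s * X 1 s - X 0 s * Y 1 s) * dcurve_w s).

Lemma curve_wD s : I s -> W s * bcv_factor m (X 0 s) (Y 0 s) = 1.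
Proof. by move=> /curve_D0 ?; rewrite /W mulVf. Qed.

Lemma curve_dw s : I s -> is_derive s 1 (W : R -> R^o) (dcurve_w s).
Proof.
move=> Is; have D0 := curve_D0 Is.
have ex := curve_dx 0 Is.
have ey := curve_dy 0 Is.
notypeclasses refine (is_derive_eq _ _).
  notypeclasses refine (is_derive_linv _ _); [exact: D0|rewrite /bcv_factor;
    isd].
by rewrite /dcurve_w /curve_w /bcv_factor /=; field.
Qed.

Lemma curve_dslope s : I s -> is_derive s 1 (slope : R -> R^o) (dslope s).
Proof.
move=> Is; have ew := curve_dw Is.
have ex := curve_dx 0 Is.
have ey := curve_dy 0 Is.
have ex1 := curve_dx 1 Is; have ey1 := curve_dy 1 Is.
notypeclasses refine (is_derive_eq _ _); first by rewrite /slope; isd.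
by rewrite /dslope /=; ring.
Qed.

Lemma curve_dcurv s : I s -> is_derive s 1 (curv : R -> R^o) (dcurv s).
Proof.
move=> Is; have ew := curve_dw Is.
have ex := curve_dx 0 Is.
have ey := curve_dy 0 Is.
have ex1 := curve_dx 1 Is; have ey1 := curve_dy 1 Is.
have ex2 := curve_dx 2 Is; have ey2 := curve_dy 2 Is.
notypeclasses refine (is_derive_eq _ _); first by rewrite /curv; isd.
by rewrite /dcurv /=; ring.
Qed.

(** Existence is enough: no formula for k'' is needed, since k'' cancels in the equation where it
    would enter. *)
Lemma curve_ddcurv s : I s -> exists d : R, is_derive s 1 (dcurv : R -> R^o) d.
Proof.
move=> Is; have ew := curve_dw Is.
have ex := curve_dx 0 Is.
have ey := curve_dy 0 Is.
have ex1 := curve_dx 1 Is; have ey1 := curve_dy 1 Is.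
have ex2 := curve_dx 2 Is; have ey2 := curve_dy 2 Is.
have ex3 := curve_dx 3 Is; have ey3 := curve_dy 3 Is.
by eexists; rewrite /dcurv /dcurve_w; isd.
Qed.

Lemma curve_near s : I s -> \near s, I s.
Proof. by move=> Is; apply: open_nbhs_nbhs. Qed.

(** Half the derivative of the unit-speed identity, which holds on a neighbourhood of s because I is
    open. *)
Lemma curve_acc s : I s ->
  X 1 s * X 2 s + Y 1 s * Y 2 s =
  2 * m * bcv_factor m (X 0 s) (Y 0 s) * (X 0 s * X 1 s + Y 0 s * Y 1 s).
Proof.
move=> Is.
have ex := curve_dx 0 Is.
have ey := curve_dy 0 Is.
have ex1 := curve_dx 1 Is; have ey1 := curve_dy 1 Is.
pose F : R -> R := fun t =>
  X 1 t ^+ 2 + Y 1 t ^+ 2 - bcv_factor m (X 0 t) (Y 0 t) ^+ 2.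
have F0 : 'D_1 (F : R -> R^o) s = 0.
  rewrite (@near_eq_derive _ _ R^o F (cst 0)) ?derive_cst//.
  near=> t; rewrite /F curve_speed ?subrr//; near: t; exact: curve_near.
have : 'D_1 (F : R -> R^o) s = 2 * (X 1 s * X 2 s + Y 1 s * Y 2 s -
   2 * m * bcv_factor m (X 0 s) (Y 0 s) * (X 0 s * X 1 s + Y 0 s * Y 1 s)).
  apply: derive_val.
  notypeclasses refine (is_derive_eq _ _); first by rewrite /F /bcv_factor; isd.
  by rewrite /bcv_factor /=; ring.
rewrite F0 => /esym/eqP; rewrite mulf_eq0 pnatr_eq0 /= subr_eq0 => /eqP; exact.
Unshelve. all: by end_near. Qed.

Lemma curve_wspeed s : I s -> (X 1 s ^+ 2 + Y 1 s ^+ 2) * W s ^+ 2 = 1.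
Proof.
by move=> Is; rewrite curve_speed// -exprMn mulrC curve_wD ?expr1n.
Qed.

(** With [curve_y2] this is the Frenet equation nabla_T T = k N in (R^2, h_1), where T = (x', y')
    and N = (-y', x'). The definition of [curv] and [curve_acc] form a linear system for x'' and y''
    with determinant x'^2 + y'^2, up to powers of W. *)
Lemma curve_x2 s : I s -> X 2 s = - (curv s * Y 1 s) +
  2 * m * W s * X 0 s * (X 1 s ^+ 2 - Y 1 s ^+ 2) + 4 * m * W s * Y 0 s * X 1 s
    * Y 1 s.
Proof.
move=> Is; apply: (@lincomb3 _ _ _ ((X 1 s ^+ 2 + Y 1 s ^+ 2) * W s ^+ 2 - 1)
  (X 1 s * X 2 s + Y 1 s * Y 2 s -
   2 * m * bcv_factor m (X 0 s) (Y 0 s) * (X 0 s * X 1 s + Y 0 s * Y 1 s))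
  (W s * bcv_factor m (X 0 s) (Y 0 s) - 1) (- X 2 s) (W s ^+ 2 * X 1 s)
  (2 * m * W s * X 1 s * (X 0 s * X 1 s + Y 0 s * Y 1 s))).
- by rewrite curve_wspeed// subrr.
- by rewrite curve_acc// subrr.
- by rewrite curve_wD// subrr.
by rewrite /curv; ring.
Qed.

Lemma curve_y2 s : I s -> Y 2 s = curv s * X 1 s +
  2 * m * W s * Y 0 s * (Y 1 s ^+ 2 - X 1 s ^+ 2) + 4 * m * W s * X 0 s * X 1 s
    * Y 1 s.
Proof.
move=> Is; apply: (@lincomb3 _ _ _ ((X 1 s ^+ 2 + Y 1 s ^+ 2) * W s ^+ 2 - 1)
  (X 1 s * X 2 s + Y 1 s * Y 2 s -
   2 * m * bcv_factor m (X 0 s) (Y 0 s) * (X 0 s * X 1 s + Y 0 s * Y 1 s))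
  (W s * bcv_factor m (X 0 s) (Y 0 s) - 1) (- Y 2 s) (W s ^+ 2 * Y 1 s)
  (2 * m * W s * Y 1 s * (X 0 s * X 1 s + Y 0 s * Y 1 s))).
- by rewrite curve_wspeed// subrr.
- by rewrite curve_acc// subrr.
- by rewrite curve_wD// subrr.
by rewrite /curv; ring.
Qed.

(** * The adapted orthonormal frame e, V, xi along the cylinder *)

Local Notation U := (hopf_surface I).
Local Notation phi := (hopf_map (X 0) (Y 0)).
Local Notation h := (bcv_metric m l).
Implicit Types (p q : 'rV[R]_2) (A B C f u : 'rV[R]_2 -> R).

Definition row3 (a b c : R) : 'rV[R]_3 :=
  \row_i (if i == 0 then a else if i == 1 then b else c).

Lemma row3E a b c : (row3 a b c 0 0 = a) * (row3 a b c 0 1 = b) *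
  (row3 a b c 0 2%:R = c).
Proof. by rewrite !mxE. Qed.

(** Minus theta(-y', x', 0): the d_z component that makes the normal xi horizontal. *)
Definition coslope s : R := l / 2 * W s * (Y 0 s * Y 1 s + X 0 s * X 1 s).

Definition dcoslope s : R :=
  l / 2 * (dcurve_w s * (Y 0 s * Y 1 s + X 0 s * X 1 s) +
           W s * (Y 1 s ^+ 2 + Y 0 s * Y 2 s + X 1 s ^+ 2 + X 0 s * X 2 s)).

Lemma curve_dcoslope s : I s -> is_derive s 1 (coslope : R -> R^o) (dcoslope s).
Proof.
move=> Is; have ew := curve_dw Is.
have ex := curve_dx 0 Is.
have ey := curve_dy 0 Is.
have ex1 := curve_dx 1 Is; have ey1 := curve_dy 1 Is.
notypeclasses refine (is_derive_eq _ _); first by rewrite /coslope; isd.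
by rewrite /dcoslope /=; field.
Qed.

(* [frame p a b c = a e + b V + c xi], where e is the horizontal lift of the
   velocity of the curve, V = d_z, and xi is the unit normal of the cylinder. *)
Definition frame p (a b c : R) : 'rV[R]_3 :=
  let s := p 0 0 in
  row3 (a * X 1 s - c * Y 1 s) (a * Y 1 s + c * X 1 s)
       (b - a * slope s + c * coslope s).

Lemma surface_near p : U p -> \near p, U p.
Proof.
move=> Up; apply: open_nbhs_nbhs; split => //.
apply: (@open_comp _ _ (fun q : 'rV[R]_2 => q 0 0)) => // q _.
exact: coord_continuous.
Qed.

Lemma hopf_dmap0 p : U p -> dmap phi 0 p = frame p 1 (slope (p 0 0)) 0.
Proof.
move=> Up; have ex := is_derive_fst (curve_dx 0 Up).
have ey := is_derive_fst (curve_dy 0 Up).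
apply/rowP; apply: ord3_ind; rewrite mxE row3E; apply: partial_val.
- rewrite (_ : (fun q => _) = fun q => X 0 (q 0 0)); last first.
    by apply/funext => q; rewrite mxE.
  by apply: (is_derive_eq ex); field.
- rewrite (_ : (fun q => _) = fun q => Y 0 (q 0 0)); last first.
    by apply/funext => q; rewrite mxE.
  by apply: (is_derive_eq ey); field.
- rewrite (_ : (fun q => _) = fun q => q 0 1); last first.
    by apply/funext => q; rewrite mxE.
  by apply: (is_derive_eq (is_derive_coord _ _ _)); rewrite mxE /=; field.
Qed.

Lemma hopf_dmap1 p : U p -> dmap phi 1 p = frame p 0 1 0.
Proof.
move=> Up; apply/rowP; apply: ord3_ind; rewrite mxE row3E; apply: partial_val.
- rewrite (_ : (fun q => _) = fun q => X 0 (q 0 0)); last first.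
    by apply/funext => q; rewrite mxE.
  by apply: (is_derive_eq (is_derive_fst0 _ _)); field.
- rewrite (_ : (fun q => _) = fun q => Y 0 (q 0 0)); last first.
    by apply/funext => q; rewrite mxE.
  by apply: (is_derive_eq (is_derive_fst0 _ _)); field.
- rewrite (_ : (fun q => _) = fun q => q 0 1); last first.
    by apply/funext => q; rewrite mxE.
  by apply: (is_derive_eq (is_derive_coord _ _ _)); rewrite mxE /=; field.
Qed.

Lemma hopf_w p : bcv_w m (phi p) = W (p 0 0).
Proof. by rewrite /bcv_w /curve_w !mxE. Qed.

(** Frenet equations along d_s phi = e + slope V: nabla e = k xi, nabla V = -(l/2) xi, nabla xi = -k
    e + (l/2) V. The summand -(l/2) slope of this k comes from the vertical part of d_s phi. *)
Lemma cov_frame0 p (V : 'rV[R]_2 -> 'rV[R]_3) A B C (dA dB dC : R) : U p ->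
  (\near p, V p = frame p (A p) (B p) (C p)) ->
  is_derive p (delta_mx 0 0) (A : 'rV[R]_2 -> R^o) dA ->
    is_derive p (delta_mx 0 0) (B : 'rV[R]_2 -> R^o) dB ->
  is_derive p (delta_mx 0 0) (C : 'rV[R]_2 -> R^o) dC ->
  let s := p 0 0 in let k := curv s - l / 2 * slope s in
  cov h phi 0 V p =
  frame p (dA - C p * k) (dB + C p * (l / 2)) (dC + A p * k - B p * (l / 2)).
Proof.
move=> Up nV hA hB hC s k.
have ex1 := is_derive_fst (curve_dx 1 Up);
  have ey1 := is_derive_fst (curve_dy 1 Up).
have ea := is_derive_fst (curve_dslope Up);
  have eb := is_derive_fst (curve_dcoslope Up).
have w0 : bcv_w m (phi p) != 0 by rewrite hopf_w invr_neq0 ?curve_D0.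
have wD := curve_wD Up; have sp := curve_wspeed Up.
have pV a d : is_derive p (delta_mx 0 0) ((fun q =>
  frame q (A q) (B q) (C q) 0 a) : 'rV[R]_2 -> R^o) d ->
  partial 0 (fun q => V q 0 a) p = d.
  move=> H; rewrite -(partial_val H); apply: near_eq_partial.
  by apply: filterS nV => q ->.
have Vp := nbhs_singleton nV.
have P0 : partial 0 (fun q => V q 0 0) p =
   dA * X 1 s + A p * X 2 s - dC * Y 1 s - C p * Y 2 s.
  apply: pV; under eq_fun do rewrite row3E.
  notypeclasses refine (is_derive_eq _ _); first isd.
  by rewrite /s; field.
have P1 : partial 0 (fun q => V q 0 1) p =
   dA * Y 1 s + A p * Y 2 s + dC * X 1 s + C p * X 2 s.
  apply: pV; under eq_fun do rewrite row3E.
  notypeclasses refine (is_derive_eq _ _); first isd.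
  by rewrite /s; field.
have P2 : partial 0 (fun q => V q 0 2%:R) p =
   dB - dA * slope s - A p * dslope s + dC * coslope s + C p * dcoslope s.
  apply: pV; under eq_fun do rewrite row3E.
  notypeclasses refine (is_derive_eq _ _); first isd.
  by rewrite /s; field.
have := curve_x2 Up; have := curve_y2 Up; rewrite -/s => F2 E2.
apply/rowP; apply: ord3_ind;
  rewrite row3E mxE big_ord3 !big_ord3 !bcv_christoffelE//
  hopf_w hopf_dmap0// Vp !row3E ?P0 ?P1 ?P2 ?[phi p 0 _]mxE /= ?ord3_nat /= -/s
    /k.
- by rewrite E2 F2 /slope /coslope; field.
- by rewrite E2 F2 /slope /coslope; field.
(* The d_z component contains the derivative of [coslope], hence W (x'^2 + y'^2), so it also needs
   unit speed and W D = 1. *)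
apply: (@lincomb3 _ _ _ ((X 1 s ^+ 2 + Y 1 s ^+ 2) * W s ^+ 2 - 1) 0
  (W s * bcv_factor m (X 0 s) (Y 0 s) - 1) (C p * (l / 2)) 0
  (- (C p * (l / 2) * W s * (X 1 s ^+ 2 + Y 1 s ^+ 2)))) => //.
- by rewrite sp subrr.
- by rewrite wD subrr.
by rewrite /dslope /dcoslope /dcurve_w E2 F2 /slope /coslope /bcv_factor; field.
Qed.

(** Along the fibres, nabla_V e = -(l/2) xi, nabla_V xi = (l/2) e, and nabla_V V = 0 since the
    fibres are geodesics. *)
Lemma cov_frame1 p (V : 'rV[R]_2 -> 'rV[R]_3) A B C (dA dB dC : R) : U p ->
  (\near p, V p = frame p (A p) (B p) (C p)) ->
  is_derive p (delta_mx 0 1) (A : 'rV[R]_2 -> R^o) dA ->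
  is_derive p (delta_mx 0 1) (B : 'rV[R]_2 -> R^o) dB ->
  is_derive p (delta_mx 0 1) (C : 'rV[R]_2 -> R^o) dC ->
  cov h phi 1 V p =
  frame p (dA + C p * (l / 2)) dB (dC - A p * (l / 2)).
Proof.
move=> Up nV hA hB hC; set s := p 0 0.
have ex1 := is_derive_fst0 (X 1) p; have ey1 := is_derive_fst0 (Y 1) p.
have ea := is_derive_fst0 slope p; have eb := is_derive_fst0 coslope p.
have w0 : bcv_w m (phi p) != 0 by rewrite hopf_w invr_neq0 ?curve_D0.
have pV a d : is_derive p (delta_mx 0 1) ((fun q =>
  frame q (A q) (B q) (C q) 0 a) : 'rV[R]_2 -> R^o) d ->
  partial 1 (fun q => V q 0 a) p = d.
  move=> H; rewrite -(partial_val H); apply: near_eq_partial.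
  by apply: filterS nV => q ->.
have Vp := nbhs_singleton nV.
have P0 : partial 1 (fun q => V q 0 0) p = dA * X 1 s - dC * Y 1 s.
  apply: pV; under eq_fun do rewrite row3E.
  notypeclasses refine (is_derive_eq _ _); first isd.
  by rewrite /s; ring.
have P1 : partial 1 (fun q => V q 0 1) p = dA * Y 1 s + dC * X 1 s.
  apply: pV; under eq_fun do rewrite row3E.
  notypeclasses refine (is_derive_eq _ _); first isd.
  by rewrite /s; ring.
have P2 : partial 1 (fun q =>
  V q 0 2%:R) p = dB - dA * slope s + dC * coslope s.
  apply: pV; under eq_fun do rewrite row3E.
  notypeclasses refine (is_derive_eq _ _); first isd.
  by rewrite /s; ring.
apply/rowP; apply: ord3_ind;
  rewrite row3E mxE big_ord3 !big_ord3 !bcv_christoffelE//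
  hopf_w hopf_dmap1// Vp !row3E ?P0 ?P1 ?P2 ?[phi p 0 _]mxE /= ?ord3_nat /= -/s;
  by rewrite /slope /coslope; field.
Qed.

Lemma frame_theta p a b c : bcv_theta m l (phi p) (frame p a b c) = b.
Proof.
rewrite /bcv_theta hopf_w !row3E ?[phi p 0 _]mxE /= /slope /coslope; ring.
Qed.

Lemma frame_ip p a b c a' b' c' : U p ->
  bcv_ip m l (phi p) (frame p a b c) (frame p a' b' c') =
  a * a' + b * b' + c * c'.
Proof.
move=> Up; rewrite /bcv_ip !frame_theta hopf_w !row3E.
have := curve_wspeed Up; set s := p 0 0 => sp.
apply: (@lincomb3 _ _ _ ((X 1 s ^+ 2 + Y 1 s ^+ 2) * W s ^+ 2 - 1) 0 0
  (a * a' + c * c') 0 0) => //; first by rewrite sp subrr.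
by ring.
Qed.

(** * The conformal metric on the cylinder and the tension field *)

Variable f : 'rV[R]_2 -> R.
Hypothesis f_gt0 : forall p, U p -> 0 < f p.
Hypothesis f_derivable : forall (k : seq 'I_2) i p, U p ->
  is_derive p (delta_mx 0 i) (foldr (@partial R 2) f k : 'rV[R]_2 -> R^o)
    (foldr (@partial R 2) f (i :: k) p).
Local Notation g := (hopf_conformal_metric m l (X 0) (Y 0) f).

(** Matrix of ds^2 + (dz + a ds)^2. *)
Definition flat_coef (a : R) (i j : nat) : R :=
  match i, j with 0, 0 => 1 + a ^+ 2 | 1, 1 => 1 | _, _ => a end.

Definition dflat_coef (a da : R) (k i j : nat) : R :=
  match k, i, j with
  | 0, 0, 0 => 2 * a * da | 0, 0, 1 | 0, 1, 0 => da | _, _, _ => 0 end.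

Lemma hopf_metricE p i j : U p ->
  g p i j = (f p)^-1 * flat_coef (slope (p 0 0)) i j.
Proof.
move=> Up; rewrite /hopf_conformal_metric mxE /pullback.
congr (_ * _); rewrite mxE bcv_metric_ip.
by move: i j; apply: ord2_ind; apply: ord2_ind;
  rewrite ?hopf_dmap0// ?hopf_dmap1// frame_ip//=; ring.
Qed.

(** The matrix [flat_coef] has determinant 1, so its inverse is its adjugate: change the sign of the
    slope and exchange the indices 0 and 1. *)
Lemma hopf_inv p i j : U p ->
  invmx (g p) i j =
  f p * flat_coef (- slope (p 0 0)) (1 - i)%N (1 - j)%N.
Proof.
move=> Up; have f0 : f p != 0 by rewrite gt_eqF ?f_gt0.
set N : 'M[R]_2 := \matrix_(i, j) (f p * flat_coef (- slope (p 0 0)) (1 - i)%N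
  (1 - j)%N).
have MN : g p *m N = 1%:M.
  apply/matrixP => a b; rewrite mxE big_ord2 !hopf_metricE// !mxE.
  by move: a b; apply: ord2_ind; apply: ord2_ind; rewrite ?eqxx ?ord3E /=;
    field.
by rewrite (invmx_right MN) mxE.
Qed.

Lemma partial_hopf_metric p k i j : U p ->
  partial k (fun q => g q i j) p =
  - (partial k f p / f p ^+ 2) * flat_coef (slope (p 0 0)) i j +
  (f p)^-1 * dflat_coef (slope (p 0 0)) (dslope (p 0 0)) k i j.
Proof.
move=> Up; have f0 : f p != 0 by rewrite gt_eqF ?f_gt0.
have fd := f_derivable [::] k Up; rewrite /= in fd.
rewrite (@near_eq_partial _ _ _ _ (fun q =>
  (f q)^-1 * flat_coef (slope (q 0 0)) i j)); last first.
  by apply: filterS (surface_near Up) => q Uq; exact: hopf_metricE.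
apply: partial_val.
have ef := is_derive_linv f0 fd.
have ea : is_derive p (delta_mx 0 k) ((fun q => slope (q 0 0)) : 'rV[R]_2 ->
  R^o)
   (if k == 0 then dslope (p 0 0) else 0).
  move: k {fd ef}; apply: ord2_ind => /=.
    exact: (is_derive_fst (curve_dslope Up)).
  exact: (is_derive_fst0 slope p).
notypeclasses refine (is_derive_eq _ _).
  notypeclasses refine (is_derive_lmul _ _); first exact: ef.
  (* One value covers both directions: [dflat_coef] is taken in direction 0, with the derivative of
     the slope set to 0 along the fibre. *)
  instantiate (1 := dflat_coef (slope (p 0 0)) (if k == 0 then dslope (p 0 0)
    else 0) 0 i j).
  by move: i j; apply: ord2_ind; apply: ord2_ind => /=;
    (notypeclasses refine (is_derive_eq _ _); [isd|rewrite /=; ring]).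
by move: k {fd ef ea}; apply: ord2_ind; move: i j; apply: ord2_ind;
  apply: ord2_ind => /=;
   field.
Qed.

Lemma hopf_christoffelE a i j p : U p ->
  christoffel g a i j p =
  (let s := p 0 0 in
   let d k i j : R := - (partial k f p / f p ^+ 2) * flat_coef (slope s) i j +
     (f p)^-1 * dflat_coef (slope s) (dslope s) k i j in
   let t (b : 'I_2) := f p * flat_coef (- slope s) (1 - a)%N (1 - b)%N *
     (d i j b + d j i b - d b i j) in
   2^-1 * (t 0 + t 1)).
Proof.
move=> Up; rewrite christoffel2; cbv beta zeta.
have EM i' j' := @hopf_inv p i' j' Up.
move: (invmx (g p)) EM => M EM; rewrite !EM {EM}.
have E k i' j' := @partial_hopf_metric p k i' j' Up.
by move: (@partial R 2) E => P E; rewrite !E.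
Qed.

(* In dimension two the conformal factor drops out of the contracted Christoffel
   symbols, so up to the factor f this is the trace for the flat metric
   phi^* h = ds^2 + (dz + slope ds)^2. *)
Lemma hopf_trace (omega : 'I_2 -> 'rV[R]_2 -> 'rV[R]_3) p c00 c01 c10 c11 o1 :
  U p -> cov h phi 0 (omega 0) p = c00 -> cov h phi 0 (omega 1) p = c01 ->
  cov h phi 1 (omega 0) p = c10 -> cov h phi 1 (omega 1) p = c11 ->
  omega 1 p = o1 ->
  trace_nabla g h phi omega p = f p *:
  (c00 - slope (p 0 0) *: (c01 + c10) + (1 + slope (p 0 0) ^+ 2) *: c11
   - dslope (p 0 0) *: o1).
Proof.
move=> Up <- <- <- <- <-; have f0 : f p != 0 by rewrite gt_eqF ?f_gt0.
apply/rowP => c; rewrite trace_nabla2 /=.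
have EG a i j := @hopf_christoffelE a i j p Up.
have EM i j := @hopf_inv p i j Up.
move: (christoffel g) (invmx (g p)) EG EM => G M EG EM.
rewrite !EG !EM {EG EM} /=.
move: (cov h phi) (@partial R 2) => K P.
move: (K 0 (omega 0) p) (K 0 (omega 1) p) (K 1 (omega 0) p) (K 1 (omega 1) p)
  (omega 0 p) (omega 1 p) (P 0 f p) (P 1 f p) => k00 k01 k10 k11 w0 w1 f0' f1'.
by rewrite !mxE; field.
Qed.

(** The terms in l * slope cancel in the trace, and so does the tangential term dslope V. The mean
    curvature trace is thus the geodesic curvature of the base curve, for every l. *)
Lemma hopf_tension p : U p ->
  tension g h phi p = frame p 0 0 (f p * curv (p 0 0)).
Proof.
move=> Up; rewrite /tension.
have n0 : \near p, dmap phi 0 p = frame p 1 (slope (p 0 0)) 0.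
  by apply: filterS (surface_near Up) => q; exact: hopf_dmap0.
have n1 : \near p, dmap phi 1 p = frame p 0 1 0.
  by apply: filterS (surface_near Up) => q; exact: hopf_dmap1.
have ea := is_derive_fst (curve_dslope Up).
have ea1 := is_derive_fst0 slope p.
have L (i : 'I_2) (c : R) := is_derive_lcst p (delta_mx 0 i) c.
have E00 := @cov_frame0 p _ (fun=> 1) _ (fun=> 0) _ _ _ Up n0 (L _ _) ea (L _
  _).
have E01 := @cov_frame0 p _ (fun=> 0) (fun=> 1) (fun=> 0) _ _ _ Up n1 (L _ _)
  (L _ _) (L _ _).
have E10 := @cov_frame1 p _ (fun=> 1) _ (fun=> 0) _ _ _ Up n0 (L _ _) ea1 (L _
  _).
have E11 := @cov_frame1 p _ (fun=> 0) (fun=> 1) (fun=> 0) _ _ _ Up n1 (L _ _)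
  (L _ _) (L _ _).
rewrite (@hopf_trace (dmap phi) p _ _ _ _ _ Up E00 E01 E10 E11 (hopf_dmap1 Up)).
by apply/rowP; apply: ord3_ind; rewrite row3E !mxE /=; field.
Qed.

(* [hopf_us], [hopf_uz] and so on are the partial derivatives of [hopf_u]. *)
Definition hopf_u p : R := f p * curv (p 0 0).

Definition hopf_us p : R :=
  partial 0 f p * curv (p 0 0) + f p * dcurv (p 0 0).

Definition hopf_uz p : R := partial 1 f p * curv (p 0 0).

Lemma derive_u0 p : U p -> is_derive p (delta_mx 0 0) (hopf_u : 'rV[R]_2 ->
  R^o) (hopf_us p).
Proof.
move=> Up; have fd : is_derive p (delta_mx 0 0) (f : 'rV[R]_2 ->
  R^o) (partial 0 f p) :=
  f_derivable [::] 0 Up.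
have ek := is_derive_fst (curve_dcurv Up).
notypeclasses refine (is_derive_eq _ _); first by rewrite /hopf_u; isd.
by rewrite /hopf_us; ring.
Qed.

Lemma derive_u1 p : U p -> is_derive p (delta_mx 0 1) (hopf_u : 'rV[R]_2 ->
  R^o) (hopf_uz p).
Proof.
move=> Up; have fd : is_derive p (delta_mx 0 1) (f : 'rV[R]_2 ->
  R^o) (partial 1 f p) :=
  f_derivable [::] 1 Up.
have ek := is_derive_fst0 curv p.
notypeclasses refine (is_derive_eq _ _); first by rewrite /hopf_u; isd.
by rewrite /hopf_uz; ring.
Qed.

(** * Covariant derivatives of the tension field and the bitension field *)

Lemma hopf_cov_tension0 p : U p ->
  let s := p 0 0 in
  cov h phi 0 (tension g h phi) p =
  frame p (- (hopf_u p * (curv s - l / 2 * slope s))) (hopf_u p * (l / 2))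
    (hopf_us p).
Proof.
move=> Up s; have nt : \near p, tension g h phi p = frame p 0 0 (hopf_u p).
  by apply: filterS (surface_near Up) => q; exact: hopf_tension.
rewrite (@cov_frame0 p _ (fun=> 0) (fun=> 0) hopf_u _ _ _ Up nt (is_derive_lcst
  _ _ _) (is_derive_lcst _ _ _) (derive_u0 Up)).
by congr frame; rewrite /s; ring.
Qed.

Lemma hopf_cov_tension1 p : U p ->
  cov h phi 1 (tension g h phi) p =
  frame p (hopf_u p * (l / 2)) 0 (hopf_uz p).
Proof.
move=> Up; have nt : \near p, tension g h phi p = frame p 0 0 (hopf_u p).
  by apply: filterS (surface_near Up) => q; exact: hopf_tension.
rewrite (@cov_frame1 p _ (fun=> 0) (fun=> 0) hopf_u _ _ _ Up nt (is_derive_lcst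
  _ _ _) (is_derive_lcst _ _ _) (derive_u1 Up)).
by congr frame; ring.
Qed.

(** The constant 4 m - l^2 / 2 is the Ricci curvature in the direction xi: the sum of the curvatures
    4 m - (3/4) l^2 of the horizontal plane and l^2 / 4 of a vertical one. *)
Lemma hopf_trace_riemann p : U p ->
  \sum_i \sum_j invmx (g p) i j *:
      riemann h (phi p) (dmap phi i p) (tension g h phi p) (dmap phi j p) =
  - frame p 0 0 (f p * (4 * m - l ^+ 2 / 2) * hopf_u p).
Proof.
move=> Up; have w0 : bcv_w m (phi p) != 0 by rewrite hopf_w invr_neq0 ?curve_D0.
pose b (i : 'I_2) : R := if i == 0 then slope (p 0 0) else 1.
have D : forall i, dmap phi i p = frame p (i == 0)%:R (b i) 0.
  by apply: ord2_ind; rewrite ?hopf_dmap0 ?hopf_dmap1.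
have E i j : invmx (g p) i j *:
      riemann h (phi p) (dmap phi i p) (tension g h phi p) (dmap phi j p) =
  (f p * flat_coef (- slope (p 0 0)) (1 - i)%N (1 - j)%N *
   - ((4 * m - 3 / 4 * l ^+ 2) * ((i == 0)%:R * (j == 0)%:R + b i * b j) +
      (l ^+ 2 - 4 * m) * b i * b j)) *: frame p 0 0 (hopf_u p).
  rewrite hopf_inv// hopf_tension// !D bcv_riemann_normal ?frame_theta//
    ?frame_ip//.
    by rewrite scalerA mulr0 addr0.
  by rewrite !(mulr0, mul0r, addr0).
under eq_bigr do under eq_bigr do rewrite E.
clear E D w0; move: (slope (p 0 0)) @b => a b;
  rewrite !big_ord2 /b /= -!scalerDl.
by apply/rowP; apply: ord3_ind; rewrite !mxE /=; field.
Qed.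

(** Second derivatives are kept unevaluated: for l <> 0 they are computed later from the first-order
    equations. *)
Definition hopf_uss p : R := 'D_(delta_mx 0 0) (hopf_us : 'rV[R]_2 -> R^o) p.
Definition hopf_usz p : R := 'D_(delta_mx 0 1) (hopf_us : 'rV[R]_2 -> R^o) p.
Definition hopf_uzs p : R := 'D_(delta_mx 0 0) (hopf_uz : 'rV[R]_2 -> R^o) p.
Definition hopf_uzz p : R := 'D_(delta_mx 0 1) (hopf_uz : 'rV[R]_2 -> R^o) p.

Lemma derivable_us i p : U p ->
  is_derive p (delta_mx 0 i) (hopf_us : 'rV[R]_2 -> R^o)
  ('D_(delta_mx 0 i) (hopf_us : 'rV[R]_2 -> R^o) p).
Proof.
move=> Up; have fd := f_derivable [::] i Up;
  have fd0 := f_derivable [:: 0] i Up.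
have [dd ed] := curve_ddcurv Up.
apply: derivableP.
suff [d [? _]] : exists d, is_derive p (delta_mx 0 i) (hopf_us : 'rV[R]_2 ->
  R^o) d by [].
rewrite /= in fd fd0; rewrite /hopf_us.
have [ek ek1] := (is_derive_fst (curve_dcurv Up), is_derive_fst0 curv p).
have [ed0 ed1] := (is_derive_fst ed, is_derive_fst0 dcurv p).
move: i fd fd0; apply: ord2_ind => fd fd0; eexists; isd.
Qed.

Lemma derivable_uz i p : U p ->
  is_derive p (delta_mx 0 i) (hopf_uz : 'rV[R]_2 -> R^o)
  ('D_(delta_mx 0 i) (hopf_uz : 'rV[R]_2 -> R^o) p).
Proof.
move=> Up; have fd := f_derivable [:: 1] i Up.
apply: derivableP.
suff [d [? _]] : exists d, is_derive p (delta_mx 0 i) (hopf_uz : 'rV[R]_2 ->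
  R^o) d by [].
rewrite /= in fd; rewrite /hopf_uz.
have [ek ek1] := (is_derive_fst (curve_dcurv Up), is_derive_fst0 curv p).
move: i fd; apply: ord2_ind => fd; eexists; isd.
Qed.

(** Since e = d_s - slope d_z, [u1] is e(u), and the second-order terms together with -dslope V(u)
    make up (e e + V V) u. In the last factor, k^2 + l^2 / 2 comes from the connection and l^2 / 2 -
    4 m from the curvature tensor. *)
Lemma hopf_bitension p : U p -> let s := p 0 0 in
  let u1 := hopf_us p - slope s * hopf_uz p in
  bitension g h phi p = f p *: frame p
    (l * hopf_uz p - 2 * curv s * u1 - hopf_u p * dcurv s)
    (l * u1)
    (hopf_uss p - slope s * (hopf_usz p + hopf_uzs p)
     + (1 + slope s ^+ 2) * hopf_uzz p - dslope s * hopf_uz p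
     - hopf_u p * (curv s ^+ 2 + l ^+ 2 - 4 * m)).
Proof.
move=> Up s u1; rewrite /bitension hopf_trace_riemann//.
pose A0 q := - (hopf_u q * (curv (q 0 0) - l / 2 * slope (q 0 0))).
pose B0 q := hopf_u q * (l / 2).
have n0 : \near p, cov h phi 0 (tension g h phi) p = frame p (A0 p) (B0 p)
  (hopf_us p).
  by apply: filterS (surface_near Up) => q; exact: hopf_cov_tension0.
have n1 : \near p, cov h phi 1 (tension g h phi) p = frame p (B0 p) 0 (hopf_uz
  p).
  by apply: filterS (surface_near Up) => q; exact: hopf_cov_tension1.
have [ek ek1] := (is_derive_fst (curve_dcurv Up), is_derive_fst0 curv p).
have [ea ea1] := (is_derive_fst (curve_dslope Up), is_derive_fst0 slope p).
have [eu eu1] := (derive_u0 Up, derive_u1 Up).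
have A00 : is_derive p (delta_mx 0 0) (A0 : 'rV[R]_2 -> R^o)
    (- (hopf_us p * (curv s - l / 2 * slope s) +
        hopf_u p * (dcurv s - l / 2 * dslope s))).
  notypeclasses refine (is_derive_eq _ _); first by rewrite /A0; isd.
  by rewrite /s /=; ring.
have A01 : is_derive p (delta_mx 0 1) (A0 : 'rV[R]_2 -> R^o)
    (- (hopf_uz p * (curv s - l / 2 * slope s))).
  notypeclasses refine (is_derive_eq _ _); first by rewrite /A0; isd.
  by rewrite /s /=; ring.
have B00 : is_derive p (delta_mx 0 0) (B0 : 'rV[R]_2 ->
  R^o) (hopf_us p * (l / 2)).
  notypeclasses refine (is_derive_eq _ _); first by rewrite /B0; isd.
  by rewrite /=; ring.
have B01 : is_derive p (delta_mx 0 1) (B0 : 'rV[R]_2 ->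
  R^o) (hopf_uz p * (l / 2)).
  notypeclasses refine (is_derive_eq _ _); first by rewrite /B0; isd.
  by rewrite /=; ring.
have L (i : 'I_2) (c : R) := is_derive_lcst p (delta_mx 0 i) c.
have E00 := @cov_frame0 p _ A0 B0 hopf_us _ _ _ Up n0 A00 B00 (derivable_us 0
  Up).
have E01 := @cov_frame0 p _ B0 (fun=> 0) hopf_uz _ _ _ Up n1 B00 (L _ _)
  (derivable_uz 0 Up).
have E10 := @cov_frame1 p _ A0 B0 hopf_us _ _ _ Up n0 A01 B01 (derivable_us 1
  Up).
have E11 := @cov_frame1 p _ B0 (fun=> 0) hopf_uz _ _ _ Up n1 B01 (L _ _)
  (derivable_uz 1 Up).
rewrite (@hopf_trace (fun j =>
  cov h phi j (tension g h phi)) p _ _ _ _ _ Up E00 E01 E10 E11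
  (hopf_cov_tension1 Up)).
rewrite -/(hopf_uss p) -/(hopf_usz p) -/(hopf_uzs p) -/(hopf_uzz p).
by rewrite /u1 /A0 /B0 /s; apply/rowP; apply: ord3_ind; rewrite !mxE /= ; field.
Qed.

(** The first two coordinates are a linear system in a and c of determinant x'^2 + y'^2 = D^2. *)
Lemma frame_eq0 p a b c : U p -> frame p a b c = 0 -> [/\ a = 0, b = 0 & c = 0].
Proof.
move=> Up; have D0 : X 1 (p 0 0) ^+ 2 + Y 1 (p 0 0) ^+ 2 != 0.
  by rewrite curve_speed// expf_neq0// curve_D0.
move=> /rowP F0; have := F0 0; have := F0 1; have := F0 2%:R.
rewrite !row3E !mxE; set s := p 0 0 in D0 * => e2 e1 e0.
have a0 : a = 0.
  apply: (mulIf D0); rewrite mul0r.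
  by apply: (@lincomb3 _ _ _ _ _ 0 (X 1 s) (Y 1 s) 0 e0 e1 erefl); ring.
have c0 : c = 0.
  apply: (mulIf D0); rewrite mul0r.
  by apply: (@lincomb3 _ _ _ _ _ 0 (- Y 1 s) (X 1 s) 0 e0 e1 erefl); ring.
by split=> //; move: e2; rewrite a0 c0 !mul0r subr0 addr0.
Qed.

(** * Consequences of biharmonicity when l <> 0 *)

Section Rigidity.
Hypothesis l0 : l != 0.
Hypothesis bih : biharmonic_on U g h phi.

Lemma bih_eqs p : U p -> let s := p 0 0 in
  [/\ hopf_uz p = dcurv s / l * hopf_u p,
      hopf_us p = slope s * (dcurv s / l * hopf_u p) &
      hopf_uss p - slope s * (hopf_usz p + hopf_uzs p)
     + (1 + slope s ^+ 2) * hopf_uzz p - dslope s * hopf_uz p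
     = hopf_u p * (curv s ^+ 2 + l ^+ 2 - 4 * m)].
Proof.
move=> Up s; have /eqP := bih Up.
rewrite hopf_bitension// scaler_eq0 gt_eqF ?f_gt0//= => /eqP /(frame_eq0 Up).
rewrite -/s => -[e1 e2 e3].
have {}e2 : hopf_us p = slope s * hopf_uz p.
  by move/eqP: e2; rewrite mulf_eq0 (negPf l0) /= subr_eq0 => /eqP.
have ez : hopf_uz p = dcurv s / l * hopf_u p.
  (* As e(u) = 0, the component along e reduces to l V(u) = u k'. *)
  rewrite e2 subrr mulr0 subr0 in e1; move/eqP: e1; rewrite subr_eq0 => /eqP e1.
  by rewrite mulrAC [dcurv s * _]mulrC -e1 mulrC mulKf.
split=> //; first by rewrite e2 ez.
by apply/eqP; rewrite -subr_eq0 e3.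
Qed.

(** The first-order equations hold on a neighbourhood and can be differentiated again. As e(u)
    vanishes there, (e e + V V) u is V V u = (k'/l)^2 u; then u, nonzero with k, is cancelled. *)
Lemma bih_normal p : U p -> curv (p 0 0) != 0 ->
  (dcurv (p 0 0) / l) ^+ 2 = curv (p 0 0) ^+ 2 + l ^+ 2 - 4 * m.
Proof.
move=> Up k0; set s := p 0 0; have [ez es en] := bih_eqs Up.
have u0 : hopf_u p != 0 by rewrite /hopf_u mulf_neq0// gt_eqF ?f_gt0.
have [d ed] := curve_ddcurv Up.
have [ed0 ed1] := (is_derive_fst ed, is_derive_fst0 dcurv p).
have [ea ea1] := (is_derive_fst (curve_dslope Up), is_derive_fst0 slope p).
have [eu eu1] := (derive_u0 Up, derive_u1 Up).
have nz : \near p, hopf_uz p = dcurv (p 0 0) / l * hopf_u p.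
  by apply: filterS (surface_near Up) => q /bih_eqs[].
have ns : \near p, hopf_us p = slope (p 0 0) * (dcurv (p 0 0) / l * hopf_u p).
  by apply: filterS (surface_near Up) => q /bih_eqs[].
have ezz : hopf_uzz p = dcurv s / l * hopf_uz p.
  rewrite /hopf_uzz (@near_eq_derive _ _ R^o _ _ _ _ nz); apply: derive_val.
  notypeclasses refine (is_derive_eq _ _); first isd.
  by rewrite /s /=; ring.
have ezs : hopf_uzs p = d / l * hopf_u p + dcurv s / l * hopf_us p.
  rewrite /hopf_uzs (@near_eq_derive _ _ R^o _ _ _ _ nz); apply: derive_val.
  notypeclasses refine (is_derive_eq _ _); first isd.
  by rewrite /s /=; ring.
have esz : hopf_usz p = slope s * (dcurv s / l * hopf_uz p).
  rewrite /hopf_usz (@near_eq_derive _ _ R^o _ _ _ _ ns); apply: derive_val.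
  notypeclasses refine (is_derive_eq _ _); first isd.
  by rewrite /s /=; ring.
have ess : hopf_uss p = dslope s * (dcurv s / l * hopf_u p) +
    slope s * (d / l * hopf_u p + dcurv s / l * hopf_us p).
  rewrite /hopf_uss (@near_eq_derive _ _ R^o _ _ _ _ ns); apply: derive_val.
  notypeclasses refine (is_derive_eq _ _); first isd.
  by rewrite /s /=; ring.
apply: (mulfI u0); rewrite -en ezz ezs esz ess es ez -/s; ring.
Qed.

Lemma bih_partial1 p : U p -> curv (p 0 0) != 0 ->
  partial 1 f p = dcurv (p 0 0) / l * f p.
Proof.
move=> Up k0; have [ez _ _] := bih_eqs Up; apply: (mulIf k0).
by rewrite -[LHS]/(hopf_uz p) ez /hopf_u mulrA.
Qed.

Lemma bih_partial0 p : U p -> curv (p 0 0) != 0 ->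
  partial 0 f p = (slope (p 0 0) * dcurv (p 0 0) / l - dcurv (p 0 0) / curv (p
    0 0)) * f p.
Proof.
move=> Up k0; have [_ es _] := bih_eqs Up; apply: (mulIf k0).
have -> : partial 0 f p * curv (p 0 0) = hopf_us p - f p * dcurv (p 0 0).
  by rewrite /hopf_us addrK.
by rewrite es /hopf_u; field; rewrite k0 l0.
Qed.

(** The derivative along the curve is the same at every height z, so increments of ln f between two
    fixed heights have derivative 0 in s. *)
Lemma ln_f0 s (z : R) : I s -> curv s != 0 ->
  is_derive s 1 ((fun s => ln (f (pt s z))) : R -> R^o)
    (slope s * dcurv s / l - dcurv s / curv s).
Proof.
move=> Is k0; have Up : U (pt s z) by rewrite /= /hopf_surface /= mxE.
have pts : pt s z 0 0 = s by rewrite mxE.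
have fd : is_derive (pt s z) (delta_mx 0 0) (f : 'rV[R]_2 ->
  R^o) (partial 0 f (pt s z)) :=
  f_derivable [::] 0 Up.
have := is_derive_slice0 fd => {}fd.
have f0 := f_gt0 Up.
have := @is_derive1_comp R (@ln R) (fun s =>
  f (pt s z)) s _ _ (is_derive1_ln f0) fd.
move/is_derive_eq; apply.
rewrite bih_partial0 ?pts//; field.
by rewrite l0 k0 gt_eqF.
Qed.

Lemma ln_f1 s (z : R) : I s -> curv s != 0 ->
  is_derive z 1 ((fun z => ln (f (pt s z))) : R -> R^o) (dcurv s / l).
Proof.
move=> Is k0; have Up : U (pt s z) by rewrite /= /hopf_surface /= mxE.
have pts : pt s z 0 0 = s by rewrite mxE.
have fd : is_derive (pt s z) (delta_mx 0 1) (f : 'rV[R]_2 ->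
  R^o) (partial 1 f (pt s z)) :=
  f_derivable [::] 1 Up.
have := is_derive_slice1 fd => {}fd.
have f0 := f_gt0 Up.
have := @is_derive1_comp R (@ln R) (fun z =>
  f (pt s z)) z _ _ (is_derive1_ln f0) fd.
move/is_derive_eq; apply.
rewrite bih_partial1 ?pts//; field.
by rewrite l0 gt_eqF.
Qed.

(** On a fibre ln f is affine with slope k'/l. Writing k' through f at the two heights makes it
    differentiable along the curve by [ln_f0], in place of an exchange of second partial
    derivatives. *)
Lemma ln_f_diff s : I s -> curv s != 0 ->
  ln (f (pt s 1)) - ln (f (pt s 0)) = dcurv s / l.
Proof.
move=> Is k0; pose F (z : R) : R := ln (f (pt s z)) - dcurv s / l * z.
have E : F 1 = F 0.
  apply: is_derive_0_is_cst => z; have e1 := ln_f1 z Is k0.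
  have e2 : is_derive z 1 ((fun z : R => z) : R ->
    R^o) 1 by exact: is_derive_id.
  notypeclasses refine (is_derive_eq _ _); first by rewrite /F; isd.
  by rewrite /=; ring.
by move: E; rewrite /F mulr1 mulr0 subr0 => <-; ring.
Qed.

Lemma near_curv s : I s -> curv s != 0 -> \near s, I s /\ curv s != 0.
Proof.
move=> Is k0; near=> t; split; near: t; first exact: curve_near.
have c : {for s, continuous curv}.
  apply: differentiable_continuous; apply/derivable1_diffP.
  by have [] := curve_dcurv Is.
exact: (cvgr_neq0 _ c).
Unshelve. all: by end_near. Qed.

Lemma curv_dcurv0 s : I s -> curv s * dcurv s = 0.
Proof.
move=> Is; have [->|k0] := eqVneq (curv s) 0; first by rewrite mul0r.
have near_k := near_curv Is k0.
have ek := curve_dcurv Is.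
have ed : is_derive s 1 (dcurv : R -> R^o) 0.
  have e1 := ln_f0 1 Is k0; have e0 := ln_f0 0 Is k0.
  (* Near s, k' equals l times the increment of ln f from height 0 to height 1, and the derivatives
     at the two heights cancel. *)
  apply: (@near_eq_is_derive _ _ R^o (fun t =>
    l * (ln (f (pt t 1)) - ln (f (pt t 0))))).
    by apply: filterS near_k => t [It kt]; rewrite ln_f_diff// mulrC divfK.
  notypeclasses refine (is_derive_eq _ _); first isd.
  by rewrite subrr mulr0 mulr0 addr0.
(* By [bih_normal], F is the constant l^2 - 4 m near s; with k'' = 0 its derivative is -2 k k'. *)
pose F t := (dcurv t / l) ^+ 2 - curv t ^+ 2 : R.
have F1 : 'D_1 (F : R -> R^o) s = - (2 * (curv s * dcurv s)).
  apply: derive_val; notypeclasses refine (is_derive_eq _ _);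
    first by rewrite /F; isd.
  by rewrite /=; ring.
have : 'D_1 (F : R -> R^o) s = 0.
  rewrite (@near_eq_derive _ _ R^o F (cst (l ^+ 2 - 4 * m))) ?derive_cst//.
  apply: filterS near_k => t [It kt]; rewrite /F.
  have Ut : U (pt t 0) by rewrite /hopf_surface /= mxE.
  by have := bih_normal Ut; rewrite mxE /= => ->//; rewrite /=; ring.
rewrite F1 => /eqP; rewrite oppr_eq0 mulf_eq0 pnatr_eq0 /= => /eqP; exact.
Qed.

End Rigidity.

(** * From local identities to constancy on the whole cylinder *)

Lemma interval_cst (J : set R) (F : R -> R) a b : is_interval J ->
  (forall s, J s -> is_derive s 1 (F : R -> R^o) 0) -> J a -> J b -> F a = F b.
Proof.
move=> iJ dF; wlog ab : a b / a < b => [H|Ja Jb].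
  move=> Ja Jb; have [ab|ba|->//] := ltgtP a b.
    exact: H.
  by apply/esym; exact: H.
have sub c : c \in `[a, b] -> J c by rewrite in_itv => acb; exact: (iJ a b).
have [||c _] := @MVT R F (fun=> 0) a b ab.
- by move=> c /subset_itv_oo_cc /sub /dF.
- by apply: derivable_within_continuous => c /sub /dF [].
by rewrite mul0r => /eqP; rewrite subr_eq0 => /eqP.
Qed.

Lemma hopf_rigidity : is_interval I -> l != 0 ->
  proper_biharmonic_on U g h phi -> forall p q, U p -> U q -> f p = f q.
Proof.
move=> iI l0 [bih nharm].
have kk0 := curv_dcurv0 l0 bih.
(* The identity k k' = 0 also holds at the zeros of k, so k^2 has zero derivative on the whole
   interval. *)
have k2 s t : I s -> I t -> curv s ^+ 2 = curv t ^+ 2.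
  apply: (interval_cst (F := fun t => curv t ^+ 2) iI) => {}t It.
  have ek := curve_dcurv It.
  notypeclasses refine (is_derive_eq _ _); first isd.
  by rewrite /= kk0 ?addr0.
(* The tension field is f k xi, so a map that is not harmonic has a point with k <> 0; constancy of
   k^2 carries this to all of I. *)
have [p0 [Up0 k0]] : exists p0, U p0 /\ curv (p0 0 0) != 0.
  apply: contrapT => H; apply: nharm => p Up; rewrite hopf_tension//.
  have -> : curv (p 0 0) = 0.
    by apply/eqP/negPn/negP => k; apply: H; exists p.
  by apply/rowP; apply: ord3_ind; rewrite row3E mxE; ring.
have kI s : I s -> curv s != 0.
  by move=> Is; rewrite -sqrf_eq0 (k2 _ (p0 0 0))// sqrf_eq0.
have dk s : I s -> dcurv s = 0.
  by move=> Is; have /eqP := kk0 _ Is;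
    rewrite mulf_eq0 (negPf (kI _ Is)) => /eqP.
have Upt s z : I s -> U (pt s z) by rewrite /hopf_surface /= mxE.
(* With k' = 0 both partial derivatives of f vanish. Any point is moved down its fibre to height 0,
   then along the curve. *)
have fz s z : I s -> f (pt s z) = f (pt s 0).
  move=> Is; apply: (@is_derive_0_is_cst R (fun z => f (pt s z)) z 0) => {}z;
    apply: is_derive_slice1.
  have e := f_derivable [::] 1 (Upt s z Is).
  have v := bih_partial1 l0 bih (Upt s z Is).
  apply: (is_derive_eq e) => /=; rewrite v mxE /=; last exact: kI.
  by rewrite dk// !mul0r.
have fs s t : I s -> I t -> f (pt s 0) = f (pt t 0).
  apply: (interval_cst (F := fun t => f (pt t 0)) iI) => {}t It.
  apply: is_derive_slice0.
  have e := f_derivable [::] 0 (Upt t 0 It).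
  have v := bih_partial0 l0 bih (Upt t 0 It).
  apply: (is_derive_eq e) => /=; rewrite v mxE /=; last exact: kI.
  by rewrite dk// mulr0 !mul0r subrr mul0r.
move=> p q Up Uq; rewrite -(pt_eta p) -(pt_eta q) fz// [RHS]fz//.
exact: fs.
Qed.

End Curve.

(** * Nonexistence for l <> 0 and the classification *)

Lemma no_proper_biharmonic_hopf (R : realType) (m l : R) :
  l != 0 -> ~ has_proper_biharmonic_hopf m l.
Proof.
move=> l0 [I [x [y [f [[oI iI sm D sp] smf f0 [p [q [Up Uq fpq]]] bih]]]]].
(* The two values of the conformal factor are distinct by assumption, so f p = f q is the
   contradiction sought. *)
apply: fpq; congr Num.sqrt.
pose X k : R -> R := derive1n k (x : R -> R^o).
pose Y k : R -> R := derive1n k (y : R -> R^o).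
have dX k s : I s -> is_derive s 1 (X k : R -> R^o) (X k.+1 s).
  by move=> /(sm k)[/is_derive1n].
have dY k s : I s -> is_derive s 1 (Y k : R -> R^o) (Y k.+1 s).
  by move=> /(sm k)[_ /is_derive1n].
have D0 s : I s -> bcv_factor m (X 0 s) (Y 0 s) != 0 by move=> /D /lt0r_neq0.
have speed s : I s ->
  X 1 s ^+ 2 + Y 1 s ^+ 2 = bcv_factor m (X 0 s) (Y 0 s) ^+ 2.
  move=> Is; have := sp s Is; have := D0 s Is.
  rewrite /bcv_base_metric !mxE big_ord2 !mxE !big_ord2 !mxE /=.
  rewrite -[x s]/(X 0 s) -[y s]/(Y 0 s) -[derive1 _ s]/(X 1 s) -[derive1 (y : R
    -> R^o) s]/(Y 1 s).
  move: (X 0 s) (Y 0 s) (X 1 s) (Y 1 s) => a b c d;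
    set B := bcv_factor _ _ _ => B0 E.
  (* The matrix form of the unit-speed condition is (x'^2 + y'^2) / D^2 = 1. *)
  have {}E : (c ^+ 2 + d ^+ 2) / B ^+ 2 = 1 by rewrite -E; ring.
  by rewrite -[LHS](divfK (expf_neq0 2 B0)) E mul1r.
have df (k : seq 'I_2) i p' : hopf_surface I p' ->
  is_derive p' (delta_mx 0 i) (foldr (@partial R 2) f k : 'rV[R]_2 -> R^o)
    (foldr (@partial R 2) f (i :: k) p').
  by move=> Up'; apply: derivableP; apply: diff_derivable; exact: smf.
exact: (hopf_rigidity oI dX dY D0 speed f0 df iI l0 bih).
Qed.

Theorem corollary3p3 (R : realType) :
  (forall m l : R, has_proper_biharmonic_hopf m l ->
     is_S2xR m l \/ is_H2xR m l \/ is_R3 m l) /\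
  (forall m l : R, is_S3 m l \/ is_Nil m l \/ is_SL2 m l \/ is_SU2 m l ->
     ~ has_proper_biharmonic_hopf m l).
Proof.
split=> m l H.
  have l0 : l = 0.
    by apply/eqP/negPn/negP => l0; exact: no_proper_biharmonic_hopf H.
  (* Once l = 0, the sign of m decides between the three spaces. *)
  by have [m0|m0|m0] := ltgtP m 0; [right; left|left|right; right].
apply: no_proper_biharmonic_hopf; apply/eqP.
by case: H => [[]|[[]|[[]|[]]]].
Qed.
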